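(* Let $A,B\subset\mathbb R$ be bounded measurable sets of finite measure, let $c>0$, and put $K_{A,B,c}=P_{cB}\mathcal FP_A$ and $m=c|A||B|$. For every $N\in\mathbb N_0$ and every $\alpha,\beta\in\mathbb R$, $$s_{N+1}(K_{A,B,c})\le\mathcal R_N(\alpha,\beta),$$ with $\mathcal R_N(\alpha,\beta)$ and $\nu_{\alpha,\beta}$ as defined in the context. For $N\ge1$ and $0\le j,k<N$ define $$G_{jk}:=\int_{\mathbb R}t^{j+k}\,d\nu_{\alpha,\beta}(t),\qquad b_j:=\int_{\mathbb R}t^je^{-it}\,d\nu_{\alpha,\beta}(t).$$ If $G^\dagger$ denotes the Moore--Penrose inverse of $G=(G_{jk})$ and $b=(b_j)$, then $$\mathcal R_N(\alpha,\beta)^2=m-b^*G^\dagger b,$$ and $$G_{jk}=c(2\pi c)^{j+k}\left(\int_A(x-\alpha)^{j+k}\,dx\right)\left(\int_B(\eta-\beta)^{j+k}\,d\eta\right).$$ Define, with the convention $|x-a|^0=1$, $$\mathcal M_N(A):=\inf_{a\in\mathbb R}\int_A|x-a|^{2N}\,dx,\qquad \mathcal M_N(B):=\inf_{b\in\mathbb R}\int_B|\eta-b|^{2N}\,d\eta,$$ $$E_N^{\mathrm{mom}}:=\frac{(2\pi c)^N\sqrt c}{N!}\bigl(\mathcal M_N(A)\mathcal M_N(B)\bigr)^{1/2}.$$ Then for every $N\in\mathbb N_0$ there is a rank-at-most-$N$ approximation to $K_{A,B,c}$ whose Hilbert--Schmidt residual is at most $E_N^{\mathrm{mom}}$, and hence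 $$s_{N+1}(K_{A,B,c})\le E_N^{\mathrm{mom}}.$$ If $D_A=\operatorname{diam}_{\mathrm{ess}}(A)$, $D_B=\operatorname{diam}_{\mathrm{ess}}(B)$ and $\zeta=\frac{\pi c}{2}D_AD_B$, then $$E_N^{\mathrm{mom}}\le\sqrt m\,\frac{\zeta^N}{N!}.$$ If $A$ and $B$ are intervals of positive length, then $$E_N^{\mathrm{mom}}=\sqrt m\,\frac{\zeta^N}{N!(2N+1)}$$ for every $N\in\mathbb N_0$ (when $N=0$ the additional factor is one); for every $N\ge1$ this is strictly smaller than $\sqrt m\,\zeta^N/N!$.
   Context: $P_E$ is multiplication by the indicator of $E$ on $L^2(\mathbb R)$; $(\mathcal Ff)(\xi)=\int_{\mathbb R}e^{-2\pi i x\xi}f(x)\,dx$. $s_1\ge s_2\ge\cdots$ are singular values with multiplicity. $\operatorname{diam}_{\mathrm{ess}}(E):=\operatorname{ess\,sup}_{x,y\in E}|x-y|$, equal to $0$ for a null set; $\zeta^0=1$. For centres $\alpha,\beta\in\mathbb R$ set $t_{\alpha,\beta}(x,\xi):=2\pi(x-\alpha)(\xi-c\beta)$ for $(x,\xi)\in A\times cB$, and let $\nu_{\alpha,\beta}$ be the push-forward under $t_{\alpha,\beta}$ of Lebesgue measure on $A\times cB$ (a finite positive Borel measure on $\mathbb R$ of total mass $m$). For $N\ge1$ let $\mathcal P_{N-1}$ be the complex polynomials of degree at most $N-1$, and $\mathcal P_{-1}:=\{0\}$. Define $\mathcal R_N(\alpha,\beta)\ge0$ by $$\mathcal R_N(\alpha,\beta)^2:=\min_{p\in\mathcal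 P_{N-1}}\int_{\mathbb R}|e^{-it}-p(t)|^2\,d\nu_{\alpha,\beta}(t)=\min_{p\in\mathcal P_{N-1}}\int_A\int_{cB}\left|e^{-it_{\alpha,\beta}(x,\xi)}-p\bigl(t_{\alpha,\beta}(x,\xi)\bigr)\right|^2d\xi\,dx,$$ so $\mathcal R_0(\alpha,\beta)=\sqrt m$. *)

(* Defs.v *)
From HB Require Import structures.
From mathcomp Require Import all_boot all_order all_algebra.
From mathcomp Require Import all_classical all_reals all_analysis.
From mathcomp Require Import ess_sup_inf.
From mathcomp Require Import complex.
Set Implicit Arguments.
Unset Strict Implicit.
Unset Printing Implicit Defensive.
Import Order.TTheory GRing.Theory Num.Theory.
Import numFieldNormedType.Exports.
Local Open Scope classical_set_scope.
Local Open Scope ring_scope.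
Local Open Scope complex_scope.

(* The reals with the sigma-algebra of all Lebesgue-measurable sets; the
   default structure on a [realType] only has the Borel sets. [leb] is Lebesgue
   measure on that sigma-algebra, [leb2] the product measure on the plane. *)
Notation lebR R := (caratheodory_type (@wlength R idfun)^*%mu).
Notation leb := (@completed_lebesgue_measure _).
Notation leb2 := (leb \x leb)%E.

Definition lebesgue_measurable (R : realType) (E : set R) : Prop :=
  measurable (E : set (lebR R)).

Definition cabs (R : realType) (z : R[i]) : R := ComplexField.Normc.normc z.

Definition expi (R : realType) (t : R) : R[i] := cos t +i* sin t.

Definition cint d (T : measurableType d) (R : realType)
    (mu : set T -> \bar R) (f : T -> R[i]) : R[i] :=
  fine (\int[mu]_x (complex.Re (f x))%:E)%E
    +i* fine (\int[mu]_x (complex.Im (f x))%:E)%E.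

(* Elements of L^2(R; C) are represented by square-integrable functions;
   equality in L^2 is equality almost everywhere. *)
Definition ae_eq_leb (R : realType) (f g : R -> R[i]) : Prop :=
  {ae leb, forall x : lebR R, f x = g x}.

Definition sqnorm (R : realType) (f : R -> R[i]) : \bar R :=
  (\int[leb]_(x in [set: lebR R]) (cabs (f x) ^+ 2)%:E)%E.

Definition L2 (R : realType) (f : R -> R[i]) : Prop :=
  [/\ measurable_fun [set: lebR R] (fun x : lebR R => complex.Re (f x) : R),
      measurable_fun [set: lebR R] (fun x : lebR R => complex.Im (f x) : R)
    & (sqnorm f < +oo)%E].

Definition inner (R : realType) (f g : R -> R[i]) : R[i] :=
  cint leb (fun x : lebR R => f x * (g x)^*).

Definition orthonormal_family (R : realType) (I : eqType)
    (e : I -> R -> R[i]) : Prop :=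
  (forall i, L2 (e i)) /\ (forall i j, inner (e i) (e j) = (i == j)%:R).

Definition orthonormal_basis (R : realType) (e : nat -> R -> R[i]) : Prop :=
  orthonormal_family e /\
  (forall f, L2 f -> (forall n, inner f (e n) = 0) -> ae_eq_leb f (fun=> 0)).

Definition L2_operator (R : realType) (T : (R -> R[i]) -> (R -> R[i])) : Prop :=
  [/\ forall f, L2 f -> L2 (T f),
      forall (a : R[i]) f g, L2 f -> L2 g ->
        ae_eq_leb (T (fun x => a * f x + g x)) (fun x => a * T f x + T g x)
    & exists M : R, forall f, L2 f -> (sqnorm (T f) <= M%:E * sqnorm f)%E].

Definition op_sub (R : realType) (T S : (R -> R[i]) -> (R -> R[i])) :=
  fun (f : R -> R[i]) (x : R) => T f x - S f x.

Definition rank_at_most (R : realType) (T : (R -> R[i]) -> (R -> R[i]))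
    (N : nat) : Prop :=
  exists g : 'I_N -> R -> R[i], (forall j, L2 (g j)) /\
    forall f, L2 f -> exists a : 'I_N -> R[i],
      ae_eq_leb (T f) (fun x => \sum_(j < N) a j * g j x).

(* (sum_n ||T e_n||^2)^(1/2) for an orthonormal basis (e_n); the value does not
   depend on the basis, and the supremum ranges over all of them. *)
Definition hs_norm (R : realType) (T : (R -> R[i]) -> (R -> R[i])) : \bar R :=
  ereal_sup [set sqrte (\sum_(0 <= n <oo) sqnorm (T (e n)))%E
            | e in @orthonormal_basis R].

Definition is_adjoint (R : realType) (T S : (R -> R[i]) -> (R -> R[i])) : Prop :=
  L2_operator S /\
  (forall f g, L2 f -> L2 g -> inner (T f) g = inner f (S g)).

(* For a compact operator T, [singular_value T n] (n >= 1) is s_n(T), the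
   square root of the n-th largest eigenvalue of T^*T counted with
   multiplicity, and 0 if T^*T has fewer than n positive eigenvalues: for
   s > 0, s <= s_n(T) iff the eigenspaces of T^*T for eigenvalues >= s^2
   contain n orthonormal eigenvectors. *)
Definition singular_value (R : realType) (T : (R -> R[i]) -> (R -> R[i]))
    (n : nat) : \bar R :=
  ereal_sup [set s%:E | s in [set s : R | 0 <= s /\ (s = 0 \/
    exists (Tadj : (R -> R[i]) -> (R -> R[i])) (u : 'I_n -> R -> R[i])
           (lam : 'I_n -> R),
      [/\ is_adjoint T Tadj, orthonormal_family u
        & forall i, s ^+ 2 <= lam i /\
            ae_eq_leb (Tadj (T (u i))) (fun x => (lam i)%:C * u i x)])]].

Definition scale_set (R : realType) (c : R) (B : set R) : set R :=
  [set c * x | x in B].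

Definition indic_mul (R : realType) (E : set R) (f : R -> R[i]) : R -> R[i] :=
  fun x => (\1_E x)%:C * f x.

(* The absolutely convergent integral; this is the unitary Fourier transform
   on L^1 /\ L^2, which contains the range of [indic_mul A] for A bounded. *)
Definition fourier (R : realType) (f : R -> R[i]) : R -> R[i] :=
  fun xi => cint leb (fun x : lebR R => expi (- (2 * pi * x * xi)) * f x).

Definition Kop (R : realType) (A B : set R) (c : R) :
    (R -> R[i]) -> (R -> R[i]) :=
  fun f => indic_mul (scale_set c B) (fourier (indic_mul A f)).

Definition tmap (R : realType) (c alpha beta : R) (z : lebR R * lebR R) : R :=
  2 * pi * ((z.1 : R) - alpha) * ((z.2 : R) - c * beta).

Definition nu (R : realType) (A B : set R) (c alpha beta : R) :
    set (measurableTypeR R) -> \bar R :=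
  pushforward
    (fun U : set (lebR R * lebR R) => leb2 (U `&` (A `*` scale_set c B)))
    (tmap c alpha beta : lebR R * lebR R -> measurableTypeR R).

Definition residual_sq (R : realType) (A B : set R) (c alpha beta : R)
    (p : {poly R[i]}) : R :=
  fine (\int[nu A B c alpha beta]_t (cabs (expi (- t) - p.[t%:C]) ^+ 2)%:E)%E.

(* Polynomials of degree at most N - 1, only 0 if N = 0; [size p] is the degree
   of p plus one, and [size 0 = 0]. *)
Definition poly_below (R : realType) (N : nat) : set {poly R[i]} :=
  [set p | (size p <= N)%N].
Arguments poly_below : clear implicits.

Definition poly_residual (R : realType) (A B : set R) (c alpha beta : R) (N : nat) : R :=
  Num.sqrt (inf [set residual_sq A B c alpha beta p | p in poly_below R N]).

Definition gram_entry (R : realType) (A B : set R) (c alpha beta : R)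
    (j k : nat) : R :=
  fine (\int[nu A B c alpha beta]_t (t ^+ (j + k))%:E)%E.

Definition gram (R : realType) (A B : set R) (c alpha beta : R) (N : nat) :
    'M[R[i]]_N :=
  \matrix_(j < N, k < N) (gram_entry A B c alpha beta j k)%:C.

Definition bvec (R : realType) (A B : set R) (c alpha beta : R) (N : nat) :
    'cV[R[i]]_N :=
  \col_(j < N) cint (nu A B c alpha beta)
    (fun t : R => (t ^+ j)%:C * expi (- t)).

Definition ctrans (R : realType) m n (M : 'M[R[i]]_(m, n)) : 'M[R[i]]_(n, m) :=
  map_mx (@conjc R) M^T.

Definition is_mp_inverse (R : realType) m n (M : 'M[R[i]]_(m, n))
    (X : 'M[R[i]]_(n, m)) : Prop :=
  [/\ M *m X *m M = M, X *m M *m X = X,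
      ctrans (M *m X) = M *m X & ctrans (X *m M) = X *m M].

(* Moore-Penrose inverse, the unique solution of the Penrose equations. *)
Definition mp_inverse (R : realType) m n (M : 'M[R[i]]_(m, n)) : 'M[R[i]]_(n, m) :=
  xget 0 [set X | is_mp_inverse M X].

Definition moment_inf (R : realType) (E : set R) (N : nat) : R :=
  inf [set \int[leb]_(x in (E : set (lebR R))) (`|(x : R) - a| ^+ (2 * N))
      | a in [set: R]].

Definition Emom (R : realType) (A B : set R) (c : R) (N : nat) : R :=
  (2 * pi * c) ^+ N * Num.sqrt c / N`!%:R *
  Num.sqrt (moment_inf A N * moment_inf B N).

(* The essential supremum of |x - y| over E x E; points outside E x E are
   discarded by the value -oo. *)
Definition ess_diam (R : realType) (E : set R) : R :=
  if leb (E : set (lebR R)) == 0%E then 0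
  else fine (ess_sup leb2 (fun z : lebR R * lebR R =>
    if z \in ((E : set (lebR R)) `*` (E : set (lebR R)))
    then (`|(z.1 : R) - (z.2 : R)|)%:E else -oo%E)).

(* Main.v *)
(* Up to unimodular factors depending on x alone and on xi alone, the kernel of
   K is e^{-it} with t = t_{alpha,beta}(x, xi).  Replacing e^{-it} by a polynomial
   p(t) of degree less than N gives a kernel of rank at most N, and the squared
   Hilbert-Schmidt norm of the difference is int |e^{-it} - p|^2 dnu.  If N + 1
   orthonormal eigenvectors of K^*K had eigenvalues at least s^2, a unit
   combination v of them would be annihilated by the finite rank operator T, so
   s <= ||K v|| = ||(K - T) v||, which is at most the Hilbert-Schmidt norm of K - T.
   Minimising over p is a least squares problem whose normal equations G x = b
   are solved by the Moore-Penrose inverse.  The Taylor polynomial of e^{-it}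
   has error at most |t|^N / N!, and the integral of t^{2N} against nu factors
   into moments of A and B.  Almost every point of A is within D_A / 2 of the
   middle of its essential hull, and for an interval the midpoint minimises the
   moment because (h + d)^n + (h - d)^n >= 2 h^n for odd n. *)
Require Import Defs.
From HB Require Import structures.
From mathcomp Require Import all_boot all_order all_algebra.
From mathcomp Require Import all_classical all_reals all_analysis.
From mathcomp Require Import ess_sup_inf measurable_realfun.
From mathcomp Require Import complex ring lra.
Set Implicit Arguments.
Unset Strict Implicit.
Unset Printing Implicit Defensive.
Import Order.TTheory GRing.Theory Num.Theory.
Import numFieldNormedType.Exports.
Local Open Scope classical_set_scope.
Local Open Scope ring_scope.
Local Open Scope complex_scope.

(** * Complex-valued square-integrable functions *)

Section ComplexIntegral.
Context d (T : measurableType d) (R : realType).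
Variable mu : {measure set T -> \bar R}.
Local Notation C := R[i].
Implicit Types (f g h : T -> C) (a : C).

(** Elements of L^2 are honest functions here, so the argument keeps identities pointwise: a kernel
    must have every section in L^2, [Kop] equals an integral operator at each point, and on the
    operator side only the eigenvalue equation has to be handled almost everywhere. The
    Hilbert-Schmidt bound applies Bessel's inequality to each section; this holds for every
    orthonormal family, hence uniformly over the bases in [hs_norm]. The Gram matrix is 0 when A or
    B is null, so solvability of G x = b is a genuine claim; it rests on b being a vector of inner
    products. Sets are Lebesgue rather than Borel measurable, so scaling by c is derived from the
    outer measure. As for the constants, one half-diameter from each set gives zeta = (2 pi c)(D_A /
    2)(D_B / 2), and for intervals each moment contributes 1/(2N+1), of which the square root of
    their product leaves one factor. *)

Definition cmeasurable f :=
  measurable_fun [set: T] (fun x => complex.Re (f x)) /\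
  measurable_fun [set: T] (fun x => complex.Im (f x)).

Definition cintegrable f :=
  mu.-integrable [set: T] (fun x => (complex.Re (f x))%:E) /\
  mu.-integrable [set: T] (fun x => (complex.Im (f x))%:E).

Lemma cabs_sqE (z : C) :
  cabs z ^+ 2 = complex.Re z ^+ 2 + complex.Im z ^+ 2.
Proof.
by case: z => a b; rewrite /cabs /= sqr_sqrtr// addr_ge0// sqr_ge0.
Qed.

Lemma mulJ_cabs (z : C) : z * z^* = (cabs z ^+ 2)%:C.
Proof.
by case: z => a b; rewrite cabs_sqE; simpc; rewrite !expr2 mulrC; congr Complex; ring.
Qed.

Lemma cabs_conj (z : C) : cabs z^* = cabs z.
Proof. by case: z => a b; rewrite /cabs /= sqrrN. Qed.

Lemma cabsM (z w : C) : cabs (z * w) = cabs z * cabs w.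
Proof. exact: ComplexField.Normc.normcM. Qed.

Lemma cabs_ge0 (z : C) : 0 <= cabs z.
Proof. by case: z => a b; rewrite sqrtr_ge0. Qed.

Lemma cmeasurable_cst a : cmeasurable (fun=> a).
Proof. by split; exact: measurable_cst. Qed.

Lemma cmeasurableD f g :
  cmeasurable f -> cmeasurable g -> cmeasurable (fun x => f x + g x).
Proof.
move=> [f1 f2] [g1 g2]; split.
  rewrite (_ : (fun x => _) = (fun x => complex.Re (f x)) \+
    (fun x => complex.Re (g x))); first exact: measurable_funD.
  by apply/funext => x /=; case: (f x) (g x) => ? ? [].
rewrite (_ : (fun x => _) = (fun x => complex.Im (f x)) \+
  (fun x => complex.Im (g x))); first exact: measurable_funD.
by apply/funext => x /=; case: (f x) (g x) => ? ? [].
Qed.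

Lemma cmeasurableM f g :
  cmeasurable f -> cmeasurable g -> cmeasurable (fun x => f x * g x).
Proof.
move=> [f1 f2] [g1 g2]; split.
  rewrite (_ : (fun x => _) =
    (fun x => complex.Re (f x)) \* (fun x => complex.Re (g x)) \-
    (fun x => complex.Im (f x)) \* (fun x => complex.Im (g x))).
    by apply: measurable_funB; apply: measurable_funM.
  by apply/funext => x /=; case: (f x) (g x) => ? ? [].
rewrite (_ : (fun x => _) =
  (fun x => complex.Re (f x)) \* (fun x => complex.Im (g x)) \+
  (fun x => complex.Im (f x)) \* (fun x => complex.Re (g x))).
  by apply: measurable_funD; apply: measurable_funM.
by apply/funext => x /=; case: (f x) (g x) => ? ? [].
Qed.

Lemma cmeasurable_conj f : cmeasurable f -> cmeasurable (fun x => (f x)^*).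
Proof.
move=> [f1 f2]; split.
  rewrite (_ : (fun x => _) = (fun x => complex.Re (f x)))//.
  by apply/funext => x /=; case: (f x).
rewrite (_ : (fun x => _) = \- (fun x => complex.Im (f x))).
  exact: measurableT_comp.
by apply/funext => x /=; case: (f x).
Qed.

Lemma cmeasurable_real (u : T -> R) :
  measurable_fun [set: T] u -> cmeasurable (fun x => (u x)%:C).
Proof. by move=> mu_; split => //=; exact: measurable_cst. Qed.

Lemma cmeasurable_cabs f : cmeasurable f ->
  measurable_fun [set: T] (fun x => cabs (f x) ^+ 2).
Proof.
move=> [f1 f2]; under eq_fun do rewrite cabs_sqE.
by apply: measurable_funD; apply: measurable_funX.
Qed.

Lemma cintegrableD f g :
  cintegrable f -> cintegrable g -> cintegrable (fun x => f x + g x).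
Proof.
move=> [f1 f2] [g1 g2]; split.
  rewrite (_ : (fun x => _) = (fun x => (complex.Re (f x))%:E) \+
    (fun x => (complex.Re (g x))%:E))%E; first exact: integrableD.
  by apply/funext => x /=; case: (f x) (g x) => ? ? [].
rewrite (_ : (fun x => _) = (fun x => (complex.Im (f x))%:E) \+
  (fun x => (complex.Im (g x))%:E))%E; first exact: integrableD.
by apply/funext => x /=; case: (f x) (g x) => ? ? [].
Qed.

Lemma cintegrableZ a f : cintegrable f -> cintegrable (fun x => a * f x).
Proof.
case: a => a b [f1 f2]; split.
  rewrite (_ : (fun x => _) = (fun x => a%:E * (complex.Re (f x))%:E) \-
    (fun x => b%:E * (complex.Im (f x))%:E))%E.
    by apply: integrableB => //; apply: integrableZl.
  by apply/funext => x /=; case: (f x).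
rewrite (_ : (fun x => _) = (fun x => a%:E * (complex.Im (f x))%:E) \+
  (fun x => b%:E * (complex.Re (f x))%:E))%E.
  by apply: integrableD => //; apply: integrableZl.
by apply/funext => x /=; case: (f x).
Qed.

Lemma cintegrable0 : cintegrable (fun=> 0).
Proof. by split; exact: integrable0. Qed.

Lemma cintegrable_sum (I : Type) (s : seq I) (F : I -> T -> C) :
  (forall i, cintegrable (F i)) -> cintegrable (fun x => \sum_(i <- s) F i x).
Proof.
move=> iF; elim: s => [|i s IH].
  rewrite (_ : (fun=> _) = (fun=> 0)); first exact: cintegrable0.
  by apply/funext => x; rewrite big_nil.
rewrite (_ : (fun=> _) = (fun x => F i x + \sum_(j <- s) F j x)).
  exact: cintegrableD.
by apply/funext => x; rewrite big_cons.
Qed.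

Lemma cintD f g : cintegrable f -> cintegrable g ->
  cint mu (fun x => f x + g x) = cint mu f + cint mu g.
Proof.
move=> [f1 f2] [g1 g2]; rewrite /cint; simpc.
have -> : (fun x => (complex.Re (f x + g x))%:E) =
    (fun x => (complex.Re (f x) + complex.Re (g x))%:E).
  by apply/funext => x /=; case: (f x) (g x) => ? ? [].
have -> : (fun x => (complex.Im (f x + g x))%:E) =
    (fun x => (complex.Im (f x) + complex.Im (g x))%:E).
  by apply/funext => x /=; case: (f x) (g x) => ? ? [].
by congr Complex; apply: RintegralD.
Qed.

Lemma cintZ a f : cintegrable f -> cint mu (fun x => a * f x) = a * cint mu f.
Proof.
case: a => a b [f1 f2]; rewrite /cint; simpc.
have -> : (fun x => (complex.Re ((a +i* b) * f x))%:E) =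
    (fun x => (a * complex.Re (f x) - b * complex.Im (f x))%:E).
  by apply/funext => x /=; case: (f x).
have -> : (fun x => (complex.Im ((a +i* b) * f x))%:E) =
    (fun x => (a * complex.Im (f x) + b * complex.Re (f x))%:E).
  by apply/funext => x /=; case: (f x).
have i1 := integrableZl measurableT a f1; have i2 := integrableZl measurableT a f2.
have i3 := integrableZl measurableT b f1; have i4 := integrableZl measurableT b f2.
congr Complex.
  apply: etrans (RintegralB measurableT i1 i4) _.
  by congr (_ - _); apply: RintegralZl.
apply: etrans (RintegralD measurableT i2 i3) _.
by congr (_ + _); apply: RintegralZl.
Qed.

Lemma cint0 : cint mu (fun=> 0) = 0.
Proof. by rewrite /cint /= integral0. Qed.

Lemma cint_conj f : cintegrable f -> cint mu (fun x => (f x)^*) = (cint mu f)^*.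
Proof.
move=> [f1 f2]; rewrite /cint /=; congr Complex.
  by congr fine; apply: eq_integral => x _; case: (f x).
rewrite -fineN -integralN//; last exact: integrable_add_def.
by congr fine; apply: eq_integral => x _; case: (f x).
Qed.

Lemma cint_sum (I : Type) (s : seq I) (F : I -> T -> C) :
  (forall i, cintegrable (F i)) ->
  cint mu (fun x => \sum_(i <- s) F i x) = \sum_(i <- s) cint mu (F i).
Proof.
move=> iF; elim: s => [|i s IH].
  rewrite big_nil (_ : (fun=> _) = (fun=> 0)); first exact: cint0.
  by apply/funext => x; rewrite big_nil.
rewrite big_cons -IH -cintD//; last exact: cintegrable_sum.
by congr cint; apply/funext => x; rewrite big_cons.
Qed.

Lemma ae_eq_cint f g : cmeasurable f -> cmeasurable g ->
  {ae mu, forall x, f x = g x} -> cint mu f = cint mu g.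
Proof.
move=> [f1 f2] [g1 g2] fg; rewrite /cint; congr Complex; congr fine;
  apply: ae_eq_integral => //; try exact/measurable_EFinP;
  by apply: filterS fg => x ->.
Qed.

Definition cL2 f := cmeasurable f /\
  (\int[mu]_(x in [set: T]) (cabs (f x) ^+ 2)%:E < +oo)%E.

(** [fine] sends an infinite integral to 0, so this is the squared norm only under [cL2]; [normsqE]
    is the bridge. *)
Definition normsq f : R := fine (\int[mu]_(x in [set: T]) (cabs (f x) ^+ 2)%:E)%E.

Lemma normsq_ge0 f : 0 <= normsq f.
Proof.
by apply: fine_ge0; apply: integral_ge0 => x _; rewrite lee_fin sqr_ge0.
Qed.

Lemma normsqE f : cL2 f ->
  ((normsq f)%:E = \int[mu]_(x in [set: T]) (cabs (f x) ^+ 2)%:E)%E.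
Proof.
move=> [_ f2]; rewrite fineK// ge0_fin_numE//.
by apply: integral_ge0 => x _; rewrite lee_fin sqr_ge0.
Qed.

Lemma cL2_integrable f : cL2 f ->
  mu.-integrable [set: T] (fun x => (cabs (f x) ^+ 2)%:E).
Proof.
move=> [mf f2]; apply/integrableP; split.
  by apply/measurable_EFinP; exact: cmeasurable_cabs.
rewrite (eq_integral (fun x => (cabs (f x) ^+ 2)%:E))// => x _.
by rewrite abse_EFin ger0_norm// sqr_ge0.
Qed.

(** Real and imaginary part of f g are dominated by |f|^2 + |g|^2: each of the four gaps is half of
    a sum of squares. *)
Lemma cintegrable_cL2M f g : cL2 f -> cL2 g -> cintegrable (fun x => f x * g x).
Proof.
move=> f2 g2; have [m1 m2] := cmeasurableM f2.1 g2.1.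
have i12 := integrableD measurableT (cL2_integrable f2) (cL2_integrable g2).
split; (apply: le_integrable i12 => //; first exact/measurable_EFinP);
  move=> x _; rewrite /= lee_fin;
  rewrite [leRHS]ger0_norm ?addr_ge0 ?sqr_ge0// !cabs_sqE;
  case: (f x) (g x) => [a b] [u v] /=; rewrite ler_norml; apply/andP; split;
  rewrite -subr_ge0.
- by rewrite (_ : _ - _ = ((a + u)^+2 + (b - v)^+2 + a^+2+b^+2+u^+2+v^+2)/2);
    [rewrite divr_ge0// !addr_ge0// sqr_ge0 | field].
- by rewrite (_ : _ - _ = ((a - u)^+2 + (b + v)^+2 + a^+2+b^+2+u^+2+v^+2)/2);
    [rewrite divr_ge0// !addr_ge0// sqr_ge0 | field].
- by rewrite (_ : _ - _ = ((a + v)^+2 + (b + u)^+2 + a^+2+b^+2+u^+2+v^+2)/2);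
    [rewrite divr_ge0// !addr_ge0// sqr_ge0 | field].
- by rewrite (_ : _ - _ = ((a - v)^+2 + (b - u)^+2 + a^+2+b^+2+u^+2+v^+2)/2);
    [rewrite divr_ge0// !addr_ge0// sqr_ge0 | field].
Qed.

Lemma cL2_conj f : cL2 f -> cL2 (fun x => (f x)^*).
Proof.
move=> [mf f2]; split; first exact: cmeasurable_conj.
by under eq_integral do rewrite cabs_conj.
Qed.

Lemma cL2Z a f : cL2 f -> cL2 (fun x => a * f x).
Proof.
move=> f2; split; first exact: cmeasurableM (cmeasurable_cst _) f2.1.
under eq_integral do rewrite cabsM exprMn EFinM.
rewrite integralZl//; last exact: cL2_integrable.
by rewrite -(normsqE f2) -EFinM ltry.
Qed.

Lemma cL2_le f (u : T -> \bar R) : cmeasurable f -> mu.-integrable [set: T] u ->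
  (forall x, (cabs (f x) ^+ 2)%:E <= u x)%E -> cL2 f.
Proof.
move=> mf iu fu; split => //.
have : mu.-integrable [set: T] (fun x => (cabs (f x) ^+ 2)%:E).
  apply: le_integrable iu => //; first exact/measurable_EFinP/cmeasurable_cabs.
  move=> x _; rewrite !gee0_abs// ?lee_fin ?sqr_ge0//.
  by apply: le_trans (fu x); rewrite lee_fin sqr_ge0.
move/integrableP => -[_]; apply: le_lt_trans.
by apply: ge0_le_integral => //= [x _||| x _];
  rewrite ?lee_fin ?sqr_ge0 ?ler_norm//;
  do ?apply: measurableT_comp => //; exact: cmeasurable_cabs.
Qed.

Lemma cL2D f g : cL2 f -> cL2 g -> cL2 (fun x => f x + g x).
Proof.
(* The majorant is 2|f|^2 + 2|g|^2; its distance to |f + g|^2 is |f - g|^2. *)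
move=> f2 g2; have := integrableD measurableT
  (integrableZl measurableT 2 (cL2_integrable f2))
  (integrableZl measurableT 2 (cL2_integrable g2)).
move=> i12; apply: cL2_le i12 _; first exact: cmeasurableD f2.1 g2.1.
move=> x; rewrite -!EFinM -EFinD lee_fin !cabs_sqE.
case: (f x) (g x) => [a b] [u v] /=; rewrite -subr_ge0.
rewrite (_ : _ - _ = (a - u)^+2 + (b - v)^+2); last by ring.
by rewrite addr_ge0 ?sqr_ge0.
Qed.

Lemma cL2_0 : cL2 (fun=> 0).
Proof.
split; first exact: cmeasurable_cst.
by rewrite integral0_eq ?ltry// => x _; rewrite cabs_sqE expr0n addr0.
Qed.

Lemma cL2_sum (I : Type) (s : seq I) (F : I -> T -> C) :
  (forall i, cL2 (F i)) -> cL2 (fun x => \sum_(i <- s) F i x).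
Proof.
move=> iF; elim: s => [|i s IH].
  rewrite (_ : (fun=> _) = (fun=> 0)); first exact: cL2_0.
  by apply/funext => x; rewrite big_nil.
rewrite (_ : (fun=> _) = (fun x => F i x + \sum_(j <- s) F j x)).
  exact: cL2D.
by apply/funext => x; rewrite big_cons.
Qed.

Lemma cL2B f g : cL2 f -> cL2 g -> cL2 (fun x => f x - g x).
Proof.
move=> f2 g2; rewrite (_ : (fun x => _) = (fun x => f x + (-1) * g x)).
  by apply: cL2D => //; exact: cL2Z.
by apply/funext => x; rewrite mulN1r.
Qed.

Definition cinner f g := cint mu (fun x => f x * (g x)^*).

Lemma cinnerDl f g h : cL2 f -> cL2 g -> cL2 h ->
  cinner (fun x => f x + g x) h = cinner f h + cinner g h.
Proof.
move=> f2 g2 h2; rewrite /cinner -cintD; try exact/cintegrable_cL2M/cL2_conj.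
by congr cint; apply/funext => x; rewrite mulrDl.
Qed.

Lemma cinnerZl a f g : cL2 f -> cL2 g ->
  cinner (fun x => a * f x) g = a * cinner f g.
Proof.
move=> f2 g2; rewrite /cinner -cintZ; try exact/cintegrable_cL2M/cL2_conj.
by congr cint; apply/funext => x; rewrite mulrA.
Qed.

Lemma cinner_conj f g : cL2 f -> cL2 g -> cinner g f = (cinner f g)^*.
Proof.
move=> f2 g2; rewrite /cinner -cint_conj; last exact/cintegrable_cL2M/cL2_conj.
by congr cint; apply/funext => x; rewrite rmorphM /= conjcK mulrC.
Qed.

Lemma cinner_normsq f : cinner f f = (normsq f)%:C.
Proof.
rewrite /cinner /cint /normsq; congr Complex.
  by congr fine; apply: eq_integral => x _; rewrite mulJ_cabs.
by under eq_integral do rewrite mulJ_cabs; rewrite /= integral0.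
Qed.

Lemma cinner_suml (I : Type) (s : seq I) (F : I -> T -> C) (b : I -> C) g :
  (forall i, cL2 (F i)) -> cL2 g ->
  cinner (fun x => \sum_(i <- s) b i * F i x) g =
  \sum_(i <- s) b i * cinner (F i) g.
Proof.
move=> iF g2; rewrite /cinner.
have Fg i : cintegrable (fun x => F i x * (g x)^*).
  exact/cintegrable_cL2M/cL2_conj.
under eq_bigr => i _ do rewrite -(cintZ (b i) (Fg i)).
rewrite -cint_sum; last by move=> i; exact: cintegrableZ.
congr cint; apply/funext => x; rewrite mulr_suml.
by apply: eq_bigr => i _; rewrite mulrA.
Qed.

Lemma cinnerBl f g h : cL2 f -> cL2 g -> cL2 h ->
  cinner (fun x => f x - g x) h = cinner f h - cinner g h.
Proof.
move=> f2 g2 h2; rewrite -[- cinner g h]mulN1r -cinnerZl// -cinnerDl//.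
  by congr cinner; apply/funext => x; rewrite mulN1r.
exact: cL2Z.
Qed.

Lemma cinner_sumr (I : Type) (s : seq I) (F : I -> T -> C) (b : I -> C) g :
  (forall i, cL2 (F i)) -> cL2 g ->
  cinner g (fun x => \sum_(i <- s) b i * F i x) =
  \sum_(i <- s) (b i)^* * cinner g (F i).
Proof.
move=> iF g2; have iZ i : cL2 (fun x => b i * F i x) by exact: cL2Z.
rewrite cinner_conj//; last exact: cL2_sum.
rewrite cinner_suml// rmorph_sum; apply: eq_bigr => i _.
by rewrite (cinner_conj (iF i) g2) rmorphM.
Qed.

Lemma normsqD_orth f g : cL2 f -> cL2 g -> cinner f g = 0 ->
  normsq (fun x => f x + g x) = normsq f + normsq g.
Proof.
move=> f2 g2 fg; apply: complexI; have fg2 := cL2D f2 g2.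
rewrite rmorphD /= -!cinner_normsq cinnerDl//.
rewrite (cinner_conj fg2 f2) (cinner_conj fg2 g2) !cinnerDl//.
by rewrite (cinner_conj f2 g2) fg !cinner_normsq conjc0 addr0 add0r !conjc_real.
Qed.

(** The remainder f - g is orthogonal to the projection g, so ||f||^2 = ||f - g||^2 + ||g||^2, and
    ||g||^2 is the sum on the left. *)
Lemma bessel (M : nat) (e : 'I_M -> T -> C) f :
  (forall i, cL2 (e i)) -> (forall i j, cinner (e i) (e j) = (i == j)%:R) ->
  cL2 f -> \sum_(i < M) cabs (cinner f (e i)) ^+ 2 <= normsq f.
Proof.
move=> e2 eON f2.
pose g x := \sum_(i < M) cinner f (e i) * e i x.
have g2 : cL2 g by apply: cL2_sum => i; exact: cL2Z.
have h2 : cL2 (fun x => f x - g x) by exact: cL2B.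
have hej j : cinner (fun x => f x - g x) (e j) = 0.
  rewrite cinnerBl// cinner_suml// (bigD1 j)//= eON eqxx mulr1 big1 ?addr0 ?subrr//.
  by move=> i /negbTE ij; rewrite eON ij mulr0.
have hg : cinner (fun x => f x - g x) g = 0.
  by rewrite cinner_sumr// big1// => i _; rewrite hej mulr0.
have -> : f = (fun x => (f x - g x) + g x) by apply/funext => x; rewrite subrK.
rewrite (normsqD_orth h2 g2 hg).
have -> : normsq g = \sum_(i < M) cabs (cinner f (e i)) ^+ 2.
  apply: complexI; rewrite -cinner_normsq {1}/g cinner_suml// rmorph_sum.
  apply: eq_bigr => i _; apply: etrans (mulJ_cabs _); congr (_ * _).
  rewrite cinner_conj// /g cinner_suml//; congr (_ ^*).
  by rewrite (bigD1 i)//= eON eqxx mulr1 big1 ?addr0//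
   => j /negbTE ij; rewrite eON ij mulr0.
(* Replacing f by (f - g) + g also changed the coefficients; this folds them back. *)
under eq_bigr => i _.
  rewrite (_ : (fun x => _) = f); last by apply/funext => x; rewrite subrK.
  over.
by rewrite lerDr normsq_ge0.
Qed.

Lemma cauchy_schwarz f g : cL2 f -> cL2 g ->
  cabs (cinner f g) ^+ 2 <= normsq f * normsq g.
Proof.
move=> f2 g2; set F := normsq f; set G := normsq g; set z := cinner f g.
(* Nonnegativity of ||a f - b g||^2, used with a = ||g||^2, b = <f, g>, or, if
   ||g|| = 0, with a = 1 and b a large multiple of <f, g>. *)
have key (a b : C) : 0 <= complex.Re (a * a^* * F%:C + b * b^* * G%:C -
    (a * b^* * z + (a * b^* * z)^*)).
  have h2 : cL2 (fun x => a * f x - b * g x) by apply: cL2B; exact: cL2Z.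
  have := normsq_ge0 (fun x => a * f x - b * g x).
  suff -> : a * a^* * F%:C + b * b^* * G%:C -
    (a * b^* * z + (a * b^* * z)^*) = (normsq (fun x => a * f x - b * g x))%:C by [].
  have fa := cL2Z a f2; have gb := cL2Z b g2.
  rewrite -cinner_normsq cinnerBl// (cinner_conj h2 fa) (cinner_conj h2 gb).
  rewrite !cinnerBl// !cinnerZl//.
  rewrite (cinner_conj fa f2) (cinner_conj fa g2) (cinner_conj gb f2) (cinner_conj gb g2).
  rewrite !cinnerZl// (cinner_conj f2 g2) -/z !cinner_normsq -/F -/G.
  case: (a) (b) (z) => [a1 a2] [b1 b2] [z1 z2]; simpc.
  by congr Complex; ring.
have G0 : 0 <= G by exact: normsq_ge0.
have F0 : 0 <= F by exact: normsq_ge0.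
move: key; rewrite cabs_sqE; case: z => p q key /=.
have [Gpos|] := ltP 0 G.
  have /= := key (G%:C) (p +i* q).
  rewrite (_ : _ - _ = G * (F * G - (p ^+ 2 + q ^+ 2))); last by ring.
  by rewrite pmulr_rge0// subr_ge0.
move=> /(conj G0)/andP/le_anti G_0.
rewrite -G_0 mulr0 leNgt; apply/negP => s_gt0.
(* The multiple is chosen so that F - 2 r s = F - 2 (F + 1), which is negative. *)
set s := p ^+ 2 + q ^+ 2 in s_gt0; pose r := (F + 1) / s.
have rs : r * s = F + 1 by rewrite divfK// gt_eqF.
have /= := key 1 (r%:C * (p +i* q)); rewrite -G_0.
rewrite (_ : _ - _ = F - 2 * (r * s)); last by rewrite /s; ring.
by rewrite rs; move: F0; lra.
Qed.

End ComplexIntegral.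

(** * Moore-Penrose inverse and least squares *)

Section MoorePenrose.
Context (R : realType).
Local Notation C := R[i].

Lemma ctransM m n p (A : 'M[C]_(m, n)) (B : 'M[C]_(n, p)) :
  ctrans (A *m B) = ctrans B *m ctrans A.
Proof. by rewrite /ctrans trmx_mul map_mxM. Qed.

Lemma ctransK m n (A : 'M[C]_(m, n)) : ctrans (ctrans A) = A.
Proof. by apply/matrixP => i j; rewrite !mxE conjcK. Qed.

Lemma ctrans_inv n (A : 'M[C]_n) : ctrans (invmx A) = invmx (ctrans A).
Proof. by rewrite /ctrans trmx_inv map_invmx. Qed.

(** The i-th diagonal entry of the product is the sum of the |A i j|^2. *)
Lemma mulmx_ctrans_eq0 m n (A : 'M[C]_(m, n)) : A *m ctrans A = 0 -> A = 0.
Proof.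
move=> A0; apply/matrixP => i j; rewrite mxE.
have /eqP := congr1 (fun M : 'M[C]_m => M i i) A0; rewrite !mxE.
rewrite psumr_eq0; last by move=> k _; rewrite !mxE mulcJ_ge0.
move=> /allP/(_ j).
rewrite mem_index_enum !mxE => /(_ isT) /=.
by rewrite mulf_eq0 conjc_eq0 orbb => /eqP.
Qed.

(** If K kills A A^* on the left, then K A times its own adjoint vanishes, so K A = 0, and K = 0
    because the rows of A are independent. *)
Lemma row_free_gram_unit m n (A : 'M[C]_(m, n)) :
  row_free A -> A *m ctrans A \in unitmx.
Proof.
move=> Afree; rewrite -row_free_unit -kermx_eq0; set K := kermx _.
apply/eqP; suff /eqP : K *m A = 0 by rewrite mulmx_free_eq0// => /eqP.
apply: mulmx_ctrans_eq0; rewrite ctransM mulmxA -(mulmxA K) /K mulmx_ker.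
by rewrite mul0mx.
Qed.

Lemma mp_inverseP m n (M : 'M[C]_(m, n)) : is_mp_inverse M (mp_inverse M).
Proof.
rewrite /mp_inverse; case: xgetP => [X _ //|noX]; exfalso.
(* For a full rank factorisation M = L Q, the inverse is
   Q^* (Q Q^* )^-1 (L^* L)^-1 L^*. *)
have [r [L [Q [LQ fL fQ]]]] : exists r (L : 'M[C]_(m, r)) (Q : 'M[C]_(r, n)),
    [/\ L *m Q = M, row_full L & row_free Q].
  exists (\rank M), (col_base M), (row_base M).
  by rewrite mulmx_base col_base_full row_base_free.
have uQ : Q *m ctrans Q \in unitmx by exact: row_free_gram_unit.
have uL : ctrans L *m L \in unitmx.
  rewrite -[X in _ *m X]ctransK; apply: row_free_gram_unit.
  by rewrite /row_free /ctrans mxrank_map mxrank_tr.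
pose U := invmx (Q *m ctrans Q); pose V := invmx (ctrans L *m L).
have cU : ctrans U = U by rewrite ctrans_inv ctransM ctransK.
have cV : ctrans V = V by rewrite ctrans_inv ctransM ctransK.
have QU : Q *m (ctrans Q *m U) = 1%:M by rewrite mulmxA mulmxV.
have VL : V *m ctrans L *m L = 1%:M by rewrite -mulmxA mulVmx.
clearbody U V; pose X := ctrans Q *m U *m (V *m ctrans L).
have MX : M *m X = L *m (V *m ctrans L).
  by rewrite -LQ /X -(mulmxA L Q) (mulmxA Q) QU mul1mx.
have XM : X *m M = ctrans Q *m U *m Q.
  by rewrite -LQ /X -(mulmxA (ctrans Q *m U)) (mulmxA (V *m _)) VL mul1mx.
apply: (noX X); split.
- by rewrite MX -LQ -(mulmxA L) (mulmxA (V *m _)) VL mul1mx.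
- by rewrite XM /X -(mulmxA (ctrans Q *m U)) (mulmxA Q) QU mul1mx.
- by rewrite MX !ctransM ctransK cV mulmxA.
- by rewrite XM !ctransM ctransK cU mulmxA.
Qed.

End MoorePenrose.

(** * Normal equations for a finite family in L^2 *)

Section LeastSquares.
Context d (T : measurableType d) (R : realType).
Variable mu : {measure set T -> \bar R}.
Local Notation C := R[i].
Variables (N : nat) (e : 'I_N -> T -> C) (f : T -> C).
Hypotheses (e2 : forall j, cL2 mu (e j)) (f2 : cL2 mu f).

(** The product is linear in its first argument; with this order of indices, G x lists the products
    of sum_k x_k e_k with the e_j. *)
Let G : 'M[C]_N := \matrix_(j, k) cinner mu (e k) (e j).
Let b : 'cV[C]_N := \col_j cinner mu f (e j).
Let comb (x : 'cV[C]_N) t := \sum_(j < N) x j ord0 * e j t.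

Let comb2 x : cL2 mu (comb x).
Proof. by apply: cL2_sum => j; exact: cL2Z. Qed.

Let cinner_comb_basis x j : cinner mu (comb x) (e j) = (G *m x) j ord0.
Proof.
rewrite /comb (cinner_suml _ (fun j => x j ord0) e2)// mxE.
by apply: eq_bigr => k _; rewrite mxE mulrC.
Qed.

Let cinner_comb g x : cL2 mu g ->
  cinner mu g (comb x) = \sum_(j < N) (x j ord0)^* * cinner mu g (e j).
Proof. by move=> g2; rewrite /comb (cinner_sumr _ (fun j => x j ord0) e2). Qed.

Let G_herm : ctrans G = G.
Proof.
by apply/matrixP => j k; rewrite !mxE (cinner_conj (e2 j) (e2 k)).
Qed.

(* The residue v of b modulo the range of G is orthogonal to that range, so
   sum_j v_j e_j has norm 0 and b, a vector of inner products with the e_j, is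
   orthogonal to v. *)
Lemma gram_normal_equation : G *m (mp_inverse G *m b) = b.
Proof.
have [GXG _ GXh _] := mp_inverseP G; set X := mp_inverse G in GXG GXh *.
pose v := b - G *m (X *m b).
have vG : ctrans v *m G = 0.
  rewrite -[X in _ *m X]G_herm -ctransM -[RHS](_ : ctrans 0 = 0); last first.
    by apply/matrixP => i j; rewrite !mxE conjc0.
  congr ctrans; rewrite /v.
  (* Since G and G X are Hermitian, the adjoint of G X G = G reads G (G X) = G, so G kills v = b - G
     X b. *)
  have /(congr1 (@ctrans _ _ _)) := GXG; rewrite ctransM GXh G_herm => GGX.
  by rewrite mulmxBr (mulmxA G X) (mulmxA G (G *m X)) GGX subrr.
have Gv : G *m v = 0.
  by rewrite -G_herm -[v]ctransK -ctransM vG; apply/matrixP => i j; rewrite !mxE conjc0.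
have comb0 : normsq mu (comb v) = 0.
  apply: complexI; rewrite -cinner_normsq cinner_comb// big1// => j _.
  by rewrite cinner_comb_basis (_ : (G *m v) j ord0 = 0) ?mulr0// Gv mxE.
have vb : ctrans v *m b = 0.
  apply/matrixP => i j; rewrite !ord1 !mxE.
  have := cauchy_schwarz f2 (comb2 v); rewrite comb0 mulr0 => h.
  have /eqP : cabs (cinner mu f (comb v)) ^+ 2 = 0.
    by apply/eqP; rewrite eq_le h sqr_ge0.
  rewrite sqrf_eq0 => /eqP /ComplexField.Normc.eq0_normc; rewrite cinner_comb//.
  by apply: etrans; apply: eq_bigr => k _; rewrite !mxE.
have : ctrans v *m v = 0.
  by rewrite {2}/v mulmxBr vb (mulmxA _ G) vG mul0mx subrr.
rewrite -[X in _ *m X]ctransK => /mulmx_ctrans_eq0 /(congr1 (@ctrans _ _ _)).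
rewrite ctransK => v0; apply/esym/eqP; rewrite -subr_eq0 -/v v0.
by apply/eqP/matrixP => i j; rewrite !mxE conjc0.
Qed.

Let x0 := mp_inverse G *m b.
Let res t := f t - comb x0 t.

Let res2 : cL2 mu res. Proof. exact: cL2B. Qed.

Let res_orth x : cinner mu res (comb x) = 0.
Proof.
rewrite cinner_comb// big1// => j _; rewrite cinnerBl// cinner_comb_basis.
by rewrite gram_normal_equation [b _ _]mxE subrr mulr0.
Qed.

(** The residual is orthogonal to every combination of the e_j, so its squared norm is <res, f> =
    ||f||^2 - <comb x0, f>, and the last product is b^* x0. *)
Lemma least_squares_value :
  (normsq mu (fun t => f t - \sum_(j < N) (mp_inverse G *m b) j ord0 * e j t))%:C =
  (normsq mu f)%:C - (ctrans b *m mp_inverse G *m b) ord0 ord0.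
Proof.
rewrite -/x0 -mulmxA -/x0 -[LHS]/((normsq mu res)%:C) -!cinner_normsq.
transitivity (cinner mu res f).
  rewrite (cinner_conj res2 res2) /res cinnerBl// -/res.
  rewrite (cinner_conj res2 (comb2 _)) res_orth conjc0 subr0.
  by rewrite (cinner_conj res2 f2) conjcK.
rewrite cinnerBl//; congr (_ - _).
rewrite (cinner_suml _ (fun j => x0 j ord0) e2)// mxE.
by apply: eq_bigr => j _; rewrite !mxE mulrC (cinner_conj f2 (e2 j)).
Qed.

(** Any competitor is the residual plus a combination of the e_j, and these are orthogonal:
    Pythagoras. *)
Lemma least_squares_min (x : 'I_N -> C) :
  normsq mu (fun t => f t - \sum_(j < N) (mp_inverse G *m b) j ord0 * e j t) <=
  normsq mu (fun t => f t - \sum_(j < N) x j * e j t).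
Proof.
pose y : 'cV[C]_N := x0 - \col_j x j.
rewrite (_ : (fun t => f t - \sum_(j < N) x j * e j t) = (fun t => res t + comb y t)).
  by rewrite (normsqD_orth res2 (comb2 y) (res_orth y)) lerDl normsq_ge0.
apply/funext => t; rewrite /res /comb /y -!addrA; congr (_ + _).
rewrite addrC -sumrB -sumrN; apply: eq_bigr => j _; rewrite !mxE; ring.
Qed.

End LeastSquares.

(** * Kernel operators and singular values *)

Section KernelOperator.
Context d (T : measurableType d) (R : realType).
Variable mu : {sigma_finite_measure set T -> \bar R}.
Local Notation C := R[i].
Local Notation mu2 := (mu \x mu)%E.
Implicit Types (k : T * T -> C) (f : T -> C).

(** Every section is required to be in L^2, not almost every one: then [kernel_op] is linear and
    obeys Cauchy-Schwarz at each point y. *)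
Definition hs_kernel k :=
  cL2 mu2 k /\ forall y, cL2 mu (fun x => k (x, y)).

Definition kernel_op k f : T -> C := fun y => cint mu (fun x => k (x, y) * f x).

Lemma hs_kernelB k1 k2 : hs_kernel k1 -> hs_kernel k2 ->
  hs_kernel (fun z => k1 z - k2 z).
Proof. by move=> [a1 b1] [a2 b2]; split=> [|y]; exact: cL2B. Qed.

(* In an argument of a product, z^* parses as Num.conj, which is only convertible to
   conjc; hence the detours around rewriting with conjc lemmas. *)
Lemma kernel_op_inner k f y : kernel_op k f y = cinner mu f (fun x => (k (x, y))^*).
Proof.
rewrite /kernel_op /cinner; congr cint; apply/funext => x.
by rewrite -[in LHS](conjcK (k _)) mulrC.
Qed.

Lemma kernel_opB k1 k2 f y : hs_kernel k1 -> hs_kernel k2 -> cL2 mu f ->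
  kernel_op (fun z => k1 z - k2 z) f y = kernel_op k1 f y - kernel_op k2 f y.
Proof.
move=> [_ h1] [_ h2] f2.
have i1 : cintegrable mu (fun x => k1 (x, y) * f x) by exact: cintegrable_cL2M.
have i2 : cintegrable mu (fun x => k2 (x, y) * f x) by exact: cintegrable_cL2M.
rewrite /kernel_op -[X in _ = _ + X]mulN1r -cintZ// -cintD//; last exact: cintegrableZ.
by congr cint; apply/funext => x; rewrite mulrBl mulN1r.
Qed.

Lemma kernel_op_linear k a f g y : hs_kernel k -> cL2 mu f -> cL2 mu g ->
  kernel_op k (fun x => a * f x + g x) y = a * kernel_op k f y + kernel_op k g y.
Proof.
move=> [_ h] f2 g2; rewrite !kernel_op_inner cinnerDl//.
- by rewrite cinnerZl//; exact: cL2_conj.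
- exact: cL2Z.
- exact: cL2_conj.
Qed.

(** Tonelli gives measurability in y for nonnegative integrands, so it is applied to the positive
    and the negative part; [fine] makes their difference real. *)
Lemma measurable_fun_integral_section (g : T * T -> R) :
  measurable_fun [set: T * T] g ->
  measurable_fun [set: T] (fun y => fine (\int[mu]_x (g (x, y))%:E)%E).
Proof.
move=> mg; apply: (@measurableT_comp _ _ _ _ _ _ (@fine R) _
  (fun y => \int[mu]_x (g (x, y))%:E)%E); first exact: fine_measurable.
rewrite [X in measurable_fun _ X](_ : _ = (fubini_G mu (EFin \o g)^\+ \- fubini_G mu (EFin \o g)^\-)%E).
  apply: emeasurable_funB; apply: measurable_fun_fubini_tonelli_G.
  - by apply: measurable_funepos; exact/measurable_EFinP.
  - by move=> z; exact: funepos_ge0.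
  - by apply: measurable_funeneg; exact/measurable_EFinP.
  - by move=> z; exact: funeneg_ge0.
by apply/funext => y; rewrite integralE; congr (_ - _)%E;
  apply: eq_integral => x _; rewrite ?funeposE ?funenegE.
Qed.

Lemma cmeasurable_kernel_op k f : cmeasurable k -> cmeasurable f ->
  cmeasurable (kernel_op k f).
Proof.
move=> mk [f1 f2].
have mf : cmeasurable (fun z : T * T => f z.1).
  by split; [exact: measurableT_comp f1 measurable_fst |
    exact: measurableT_comp f2 measurable_fst].
have [m1 m2] := cmeasurableM mk mf.
by split; [exact: (measurable_fun_integral_section m1) |
  exact: (measurable_fun_integral_section m2)].
Qed.

Lemma integral_normsq_section k : hs_kernel k ->
  (\int[mu]_y (normsq mu (fun x => k (x, y)))%:E =
   \int[mu2]_z (cabs (k z) ^+ 2)%:E)%E.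
Proof.
move=> [k2 ks]; rewrite fubini_tonelli2.
- by apply: eq_integral => y _; rewrite normsqE.
- by apply/measurable_EFinP; exact: cmeasurable_cabs k2.1.
- by move=> z; rewrite lee_fin sqr_ge0.
Qed.

Lemma measurable_normsq_section k : hs_kernel k ->
  measurable_fun [set: T] (fun y => normsq mu (fun x => k (x, y))).
Proof.
move=> [k2 _]; apply: (measurable_fun_integral_section (g := fun z => cabs (k z) ^+ 2)).
exact: cmeasurable_cabs k2.1.
Qed.

Lemma normsq_conj f : normsq mu (fun x => (f x)^*) = normsq mu f.
Proof. by rewrite /normsq; under eq_integral do rewrite cabs_conj. Qed.

(** The Hilbert-Schmidt norm dominates the operator norm: Cauchy-Schwarz at each y, then integration
    over y. *)
Lemma kernel_op_bound k f : hs_kernel k -> cL2 mu f ->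
  (\int[mu]_y (cabs (kernel_op k f y) ^+ 2)%:E <=
   (normsq mu2 k * normsq mu f)%:E)%E.
Proof.
move=> hk f2; have [k2 ks] := hk.
apply: (@le_trans _ _ (\int[mu]_y ((normsq mu f)%:E *
    (normsq mu (fun x => k (x, y)))%:E))%E).
  apply: ge0_le_integral => //.
  - by move=> y _; rewrite lee_fin sqr_ge0.
  - by apply/measurable_EFinP/cmeasurable_cabs/(cmeasurable_kernel_op k2.1 f2.1).
  - apply/measurable_EFinP/measurable_funM => //; exact: measurable_normsq_section.
  - move=> y _; rewrite -EFinM lee_fin kernel_op_inner -(normsq_conj (fun x => k (x, y))).
    by apply: cauchy_schwarz => //; exact: cL2_conj.
rewrite ge0_integralZl ?lee_fin ?normsq_ge0//.
- by rewrite integral_normsq_section// -normsqE// -EFinM mulrC.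
- exact/measurable_EFinP/measurable_normsq_section.
- by move=> y _; rewrite lee_fin normsq_ge0.
Qed.

Lemma cL2_kernel_op k f : hs_kernel k -> cL2 mu f -> cL2 mu (kernel_op k f).
Proof.
move=> hk f2; split; first exact: cmeasurable_kernel_op hk.1.1 f2.1.
exact: le_lt_trans (kernel_op_bound hk f2) (ltry _).
Qed.

(** At a fixed y the numbers (K e_i)(y) are, up to conjugation, the coefficients of the conjugated
    section k(., y), so Bessel bounds their squares by its norm; integrate over y. *)
Lemma kernel_op_bessel k (M : nat) (e : 'I_M -> T -> C) : hs_kernel k ->
  (forall i, cL2 mu (e i)) -> (forall i j, cinner mu (e i) (e j) = (i == j)%:R) ->
  (\sum_(i < M) \int[mu]_y (cabs (kernel_op k (e i) y) ^+ 2)%:E <=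
   (normsq mu2 k)%:E)%E.
Proof.
move=> hk e2 eON; have [k2 ks] := hk.
have mke i : measurable_fun [set: T] (fun y => (cabs (kernel_op k (e i) y) ^+ 2)%:E).
  exact/measurable_EFinP/cmeasurable_cabs/(cmeasurable_kernel_op k2.1 (e2 i).1).
rewrite -ge0_integral_sum//; last by move=> i y _; rewrite lee_fin sqr_ge0.
rewrite normsqE// -integral_normsq_section//.
apply: ge0_le_integral => //.
- by move=> y _; apply: sume_ge0 => i _; rewrite lee_fin sqr_ge0.
- by apply: emeasurable_sum.
- exact/measurable_EFinP/measurable_normsq_section.
- move=> y _; rewrite sumEFin lee_fin -(normsq_conj (fun x => k (x, y))).
  have := bessel e2 eON (cL2_conj (ks y)); apply: le_trans.
  apply: ler_sum => i _; rewrite kernel_op_inner (cinner_conj (cL2_conj (ks y)) (e2 i)).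
  by rewrite cabs_conj.
Qed.

End KernelOperator.

Section LebesgueL2.
Context (R : realType).
Local Notation C := R[i].
Local Notation leb := (@completed_lebesgue_measure R).
Implicit Types (f g : R -> C) (k s : lebR R * lebR R -> C).

Lemma L2P f : L2 f <-> cL2 leb f.
Proof. by split=> [[? ? ?]|[[? ?] ?]]. Qed.

Lemma kernel_op_L2_operator k : hs_kernel leb k -> L2_operator (kernel_op leb k).
Proof.
move=> hk; split.
- by move=> f /L2P f2; apply/L2P; exact: cL2_kernel_op.
- move=> a f g /L2P f2 /L2P g2; apply: aeW => x; exact: kernel_op_linear.
- exists (normsq (leb \x leb)%E k) => f /L2P f2; apply: le_trans (kernel_op_bound hk f2) _.
  by rewrite EFinM (normsqE f2).
Qed.

(** For any basis, each partial sum of the series is a finite Bessel sum, and the bound passes to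
    the limit and then to the supremum over bases. *)
Lemma kernel_op_hs_norm (T : (R -> C) -> R -> C) k (r : R) : hs_kernel leb k ->
  (forall f, L2 f -> T f = kernel_op leb k f) -> 0 <= r ->
  normsq (leb \x leb)%E k <= r ^+ 2 -> (hs_norm T <= r%:E)%E.
Proof.
move=> hk Tk r0 kr; apply: ge_ereal_sup => _ [e [[e2 eON] _] <-].
rewrite -(ger0_norm r0) -sqrtr_sqr -[X in (_ <= X)%E]/(sqrte (r ^+ 2)%:E).
rewrite lee_sqrt ?lee_fin ?sqr_ge0//.
apply: (@le_trans _ _ (normsq (leb \x leb)%E k)%:E); last by rewrite lee_fin.
apply: lime_le; first by apply: is_cvg_nneseries => n _ _; apply: integral_ge0 => x _;
  rewrite lee_fin sqr_ge0.
apply: nearW => M; rewrite big_mkord.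
under eq_bigr do rewrite Tk//.
have e2' (i : 'I_M) : cL2 leb (e i) by exact/L2P.
have eON' (i j : 'I_M) : cinner leb (e i) (e j) = (i == j)%:R.
  by rewrite -[LHS]/(inner _ _) eON.
exact: kernel_op_bessel hk e2' eON'.
Qed.

End LebesgueL2.

(** * Singular values against finite rank kernels *)

Section SingularValueBound.
Context (R : realType).
Local Notation C := R[i].
Local Notation leb := (@completed_lebesgue_measure R).

Lemma ae_eq_cinner d (T : measurableType d) (mu : {measure set T -> \bar R})
    (f g h : T -> C) : cL2 mu f -> cL2 mu g -> cL2 mu h ->
  {ae mu, forall x, g x = h x} -> cinner mu f g = cinner mu f h.
Proof.
move=> [mf _] [mg _] [mh _] gh; apply: ae_eq_cint.
- by apply: cmeasurableM => //; exact: cmeasurable_conj.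
- by apply: cmeasurableM => //; exact: cmeasurable_conj.
- by apply: filterS gh => x ->.
Qed.

Lemma nonzero_left_kernel (F : fieldType) (N : nat) (M : 'M[F]_(N.+1, N)) :
  exists2 a : 'rV[F]_N.+1, a != 0 & a *m M = 0.
Proof.
have : kermx M != 0.
  rewrite kermx_eq0 /row_free; apply/eqP => rk.
  by have := rank_leq_col M; rewrite rk ltnn.
case/rowV0Pn => a /sub_kermxP aM a0; by exists a.
Qed.

(* Some nonzero combination of the N + 1 eigenvectors is killed by the N
   functionals, hence by the finite rank kernel s; on it T acts as k - s. *)
Lemma singular_value_le (T : (R -> C) -> R -> C) (k s : lebR R * lebR R -> C)
    (N : nat) (phi : 'I_N -> R -> C) (r : R) :
  hs_kernel leb k -> hs_kernel leb s ->
  (forall f, L2 f -> T f = kernel_op leb k f) ->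
  (forall j, cL2 leb (phi j)) ->
  (forall f, L2 f -> (forall j, cinner leb f (phi j) = 0) ->
    forall y, kernel_op leb s f y = 0) ->
  0 <= r -> normsq (leb \x leb)%E (fun z => k z - s z) <= r ^+ 2 ->
  (singular_value T N.+1 <= r%:E)%E.
Proof.
move=> hk hs Tk phi2 sphi r0 ksr; apply: ge_ereal_sup => _ [t [t0 tP] <-].
rewrite lee_fin; case: tP => [->//|[Tadj [u [lam [[[Tadj2 _ _] adj] [u2 uON] ulam]]]]].
have u2' i : cL2 leb (u i) by exact/L2P.
have [a a0 aM] := nonzero_left_kernel
  (\matrix_(i < N.+1, j < N) cinner leb (u i) (phi j)).
pose v x := \sum_(i < N.+1) a ord0 i * u i x.
have v2 : cL2 leb v by apply: cL2_sum => i; exact: cL2Z.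
have v2L : L2 v by exact/L2P.
have v_phi j : cinner leb v (phi j) = 0.
  rewrite (cinner_suml _ (fun i => a ord0 i) u2')//.
  have := congr1 (fun M : 'M[C]_(1, N) => M ord0 j) aM; rewrite !mxE => /(etrans _); apply.
  by apply: eq_bigr => i _; rewrite mxE.
have Tu2 i : cL2 leb (T (u i)) by rewrite (Tk _ (u2 i)); exact: cL2_kernel_op hk (u2' i).
have TuL i : L2 (T (u i)) by apply/L2P/Tu2.
have uON' i j : cinner leb (u i) (u j) = (i == j)%:R by exact: uON.
(* Linearity at every point, since T agrees with a kernel operator on L^2. *)
have Tv y : T v y = \sum_(i < N.+1) a ord0 i * T (u i) y.
  rewrite (Tk _ v2L) kernel_op_inner.
  rewrite (cinner_suml _ (fun i => a ord0 i) u2'); last exact/cL2_conj/hk.2.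
  by apply: eq_bigr => i _; rewrite (Tk _ (u2 i)) kernel_op_inner.
(* The images T u_i stay orthogonal, by <T u_i, T u_j> = <T^* T u_i, u_j>. Hence ||T v||^2 is the
   sum of the lam_i |a_i|^2, where every lam_i is at least t^2. *)
have TuTu i j : cinner leb (T (u i)) (T (u j)) = (lam i)%:C * (i == j)%:R.
  have [_ Tadjui] := ulam i.
  have adjE : cinner leb (T (u j)) (T (u i)) = cinner leb (u j) (Tadj (T (u i))).
    exact: (adj _ _ (u2 j) (TuL i)).
  have lu2 : cL2 leb (fun x => (lam i)%:C * u i x) by exact: cL2Z (u2' i).
  have Tadj2' : cL2 leb (Tadj (T (u i))) by apply/L2P/Tadj2/TuL.
  rewrite (cinner_conj (Tu2 j) (Tu2 i)) adjE (ae_eq_cinner (u2' j) Tadj2' lu2 Tadjui).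
  by rewrite -(cinner_conj (u2' j) lu2) (cinnerZl _ (u2' i) (u2' j)) uON'.
pose n2 := \sum_(i < N.+1) cabs (a ord0 i) ^+ 2.
have normv : normsq leb v = n2.
  apply: complexI; rewrite -cinner_normsq {1}/v (cinner_suml _ (fun i => a ord0 i) u2')//.
  rewrite rmorph_sum; apply: eq_bigr => i _; apply: etrans (mulJ_cabs _).
  congr (_ * _); rewrite (cinner_sumr _ (fun i => a ord0 i) u2')// (bigD1 i)//=.
  rewrite uON' eqxx mulr1 big1 ?addr0// => j ji.
  by rewrite uON' eq_sym (negbTE ji) mulr0.
have normTv : normsq leb (T v) = \sum_(i < N.+1) lam i * cabs (a ord0 i) ^+ 2.
  pose w y := \sum_(i < N.+1) a ord0 i * T (u i) y.
  have w2 : cL2 leb w by apply: cL2_sum => i; exact: cL2Z.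
  have -> : T v = w by exact/funext.
  apply: complexI; rewrite -cinner_normsq {1}/w (cinner_suml _ (fun i => a ord0 i) Tu2 w2).
  rewrite rmorph_sum; apply: eq_bigr => i _.
  rewrite (cinner_sumr _ (fun i => a ord0 i) Tu2 (Tu2 i)) (bigD1 i)//=.
  rewrite TuTu eqxx mulr1 big1 ?addr0; last first.
    by move=> j ji; rewrite TuTu eq_sym (negbTE ji) !mulr0.
  rewrite [RHS](_ : _ = (lam i)%:C * (cabs (a ord0 i) ^+ 2)%:C); last exact: rmorphM.
  by rewrite -mulJ_cabs; ring.
have n2_gt0 : 0 < n2.
  rewrite lt_neqAle sumr_ge0 ?andbT => [|i _]; last exact: sqr_ge0.
  apply: contra a0 => /eqP/esym/eqP; rewrite psumr_eq0 => [|i _]; last exact: sqr_ge0.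
  move=> /allP a0; apply/eqP/matrixP => i j; rewrite ord1 mxE.
  have := a0 j (mem_index_enum _); rewrite /= sqrf_eq0 => /eqP.
  exact: ComplexField.Normc.eq0_normc.
have le1 : normsq leb (T v) <= r ^+ 2 * n2.
  have -> : T v = kernel_op leb (fun z => k z - s z) v.
    apply/funext => y; rewrite kernel_opB// (Tk _ v2L).
    by rewrite (sphi _ v2L v_phi) subr0.
  have hks := hs_kernelB hk hs.
  rewrite -lee_fin normsqE; last exact: cL2_kernel_op.
  apply: le_trans (kernel_op_bound hks v2) _.
  by rewrite lee_fin normv ler_wpM2r// ltW.
have le2 : t ^+ 2 * n2 <= normsq leb (T v).
  rewrite normTv mulr_sumr; apply: ler_sum => i _.
  by apply: ler_wpM2r; [exact: sqr_ge0 | exact: (ulam i).1].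
have := le_trans le2 le1; rewrite ler_pM2r//.
by rewrite ler_sqr ?nnegrE.
Qed.

End SingularValueBound.

(** * Scaling of Lebesgue measure *)

Section LebesgueScaling.
Context (R : realType).
Local Notation leb := (@completed_lebesgue_measure R).
Implicit Types (c : R) (X E : set R).

Lemma scale_setE c X : c != 0 -> scale_set c X = (fun x => c^-1 * x) @^-1` X.
Proof.
move=> c0; apply/seteqP; split=> [_ [x Xx <-]|y /= Xy]; first by rewrite /= mulKf.
by exists (c^-1 * y) => //; rewrite mulVKf.
Qed.

Lemma scale_setK c X : c != 0 -> scale_set c^-1 (scale_set c X) = X.
Proof.
move=> c0; rewrite !scale_setE ?invr_eq0//; apply/seteqP; split=> x /=;
  by rewrite invrK mulKf.
Qed.

Lemma scale_setI c X E : c != 0 ->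
  scale_set c (X `&` E) = scale_set c X `&` scale_set c E.
Proof. by move=> c0; rewrite !scale_setE. Qed.

Lemma scale_setC c X : c != 0 -> scale_set c (~` X) = ~` scale_set c X.
Proof. by move=> c0; rewrite !scale_setE. Qed.

Lemma scale_set_itv c a b : 0 < c ->
  scale_set c `]a, b]%classic = `]c * a, c * b]%classic.
Proof.
move=> c0; rewrite scale_setE ?gt_eqF//; apply/seteqP; split=> x /=;
  by rewrite !in_itv/= ltr_pdivlMl// ler_pdivrMl.
Qed.

Local Notation wlen := (@wlength R idfun).

Lemma wlength_ocitv a b : wlen `]a, b]%classic = (Num.max 0 (b - a))%:E.
Proof.
rewrite wlength_itv/= lte_fin; case: ltP => ab.
  by rewrite -EFinD max_r// subr_ge0 ltW.
by rewrite max_l// subr_le0.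
Qed.

(** [leb] is the outer measure on arbitrary sets: scaling each half-open interval of a cover of X
    covers the scaled set, at c times the length. The reverse inequality is this one for c^-1. *)
Lemma leb_scale_le c X : 0 < c -> (leb (scale_set c X) <= c%:E * leb X)%E.
Proof.
move=> c0; have cn0 : c != 0 by rewrite gt_eqF.
rewrite -lee_pdivrMl//; apply: le_ereal_inf_tmp => _ [F [mF XF] <-].
rewrite lee_pdivrMl// -nneseriesZl; last first.
  by move=> i _; exact: wlength_ge0.
apply: ereal_inf_lbound; exists (fun i => scale_set c (F i)).
  split=> [i|_ [x Xx <-]].
    have [[a b] _ /= <-] := mF i; rewrite scale_set_itv//.
    exact: is_ocitv.
  by have [i _ Fx] := XF _ Xx; exists i => //; exists x.
apply: eq_eseriesr => i _; have [[a b] _ /= <-] := mF i.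
rewrite scale_set_itv// !wlength_ocitv/= -EFinM -mulrBr; congr EFin.
by rewrite maxr_pMr ?ltW// mulr0.
Qed.

Lemma leb_scale c X : 0 < c -> leb (scale_set c X) = (c%:E * leb X)%E.
Proof.
move=> c0; have cn0 : c != 0 by rewrite gt_eqF.
apply/eqP; rewrite eq_le leb_scale_le//=.
rewrite -lee_pdivlMl// -{1}(scale_setK X cn0) leb_scale_le ?invr_gt0//.
Qed.

Lemma lebesgue_measurableP E : lebesgue_measurable E <->
  (forall X, leb X = (leb (X `&` E) + leb (X `&` ~` E))%E).
Proof. by split=> h; exact: h. Qed.

(** Caratheodory's criterion for the scaled set, tested on X, is c times the criterion for E tested
    on X scaled by c^-1. *)
Lemma measurable_scale_set c E : 0 < c ->
  lebesgue_measurable E -> lebesgue_measurable (scale_set c E).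
Proof.
move=> c0 /lebesgue_measurableP mE; apply/lebesgue_measurableP => X.
have cn0 : c != 0 by rewrite gt_eqF.
have ci : 0 < c^-1 by rewrite invr_gt0.
have XE : X = scale_set c (scale_set c^-1 X).
  by rewrite -{1}(scale_setK X (invr_neq0 cn0)) invrK.
rewrite {1}XE [X in X `&` _]XE [X in X `&` ~` _]XE -scale_setC// -!scale_setI//.
have leb_ge0 Y : (0 <= leb Y)%E by apply: mu_ext_ge0 => Z; exact: wlength_ge0.
by rewrite !leb_scale// -ge0_muleDr// -(mE (scale_set c^-1 X)) leb_scale.
Qed.

Lemma measurable_fun_scale c : 0 < c ->
  measurable_fun [set: lebR R] (fun x : lebR R => c * x : lebR R).
Proof.
move=> c0 _ E mE; rewrite setTI.
rewrite (_ : _ @^-1` _ = scale_set c^-1 E).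
  by apply: measurable_scale_set; rewrite ?invr_gt0.
by rewrite scale_setE ?invr_eq0 ?gt_eqF// invrK.
Qed.

Lemma measurable_id_leb :
  measurable_fun [set: lebR R] (fun x : lebR R => x : measurableTypeR R).
Proof. by move=> _ E mE; rewrite setTI; exact: sub_caratheodory. Qed.

Lemma measurable_fun_leb d (T : measurableType d) (f : measurableTypeR R -> T) :
  measurable_fun [set: measurableTypeR R] f ->
  measurable_fun [set: lebR R] (f : lebR R -> T).
Proof. by move=> mf; exact: measurableT_comp mf measurable_id_leb. Qed.

(** The push-forward of [leb] along the identity to the Borel structure is [lebesgue_measure]; this
    gives Borel integrands access to the fundamental theorem of calculus. *)
Lemma ge0_integral_leb (E : set R) (f : R -> \bar R) :
  measurable (E : set (measurableTypeR R)) ->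
  measurable_fun (E : set (measurableTypeR R)) f -> (forall x, 0 <= f x)%E ->
  (\int[leb]_(x in (E : set (lebR R))) f x =
   \int[lebesgue_measure]_(x in (E : set (measurableTypeR R))) f x)%E.
Proof.
move=> mE mf f0.
have := @ge0_integral_pushforward _ _ _ _ R _ measurable_id_leb leb _ f mE mf.
by rewrite preimage_id => <- // x _; exact: f0.
Qed.

(** The push-forward of [leb] under x -> c x is c^-1 times [leb]. *)
Lemma ge0_integral_scale c (E : set R) (f : R -> \bar R) : 0 < c ->
  lebesgue_measurable E -> measurable_fun [set: lebR R] (f : lebR R -> \bar R) ->
  (forall x, 0 <= f x)%E ->
  (\int[leb]_(x in (scale_set c E : set (lebR R))) f x =
   c%:E * \int[leb]_(x in (E : set (lebR R))) f (c * x)%R)%E.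
Proof.
move=> c0 mE mf f0; have cn0 : c != 0 by rewrite gt_eqF.
have ci : 0 < c^-1 by rewrite invr_gt0.
have mcE := measurable_scale_set c0 mE.
have := @ge0_integral_pushforward _ _ _ _ R _ (measurable_fun_scale c0) leb _ f mcE
  (measurable_funTS mf) (fun x _ => f0 x).
rewrite (_ : (fun x => c * x) @^-1` _ = E); last first.
  by rewrite -[RHS](scale_setK E cn0) [RHS]scale_setE ?invr_eq0// invrK.
move=> <-; pose k : {nonneg R} := NngNum (ltW ci).
have -> : pushforward leb (fun x : lebR R => c * x : lebR R) = mscale k leb.
  apply/funext => X; rewrite /pushforward /mscale /= -leb_scale// scale_setE//.
    by rewrite invrK.
  by rewrite invr_eq0.
rewrite ge0_integral_mscale//; last exact: measurable_funTS.
by rewrite muleA -EFinM mulfV// mul1e.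
Qed.

End LebesgueScaling.

(** * Taylor polynomials of the exponential *)

Section TaylorExpi.
Context (R : realType).
Implicit Types (p q : {poly R}).

(** At i = 0 the coefficient is a division by 0, which yields 0: this antiderivative vanishes at the
    origin. *)
Definition antideriv p : {poly R} := \poly_(i < (size p).+1) (p`_i.-1 / i%:R).

Lemma antiderivK p : (antideriv p)^`() = p.
Proof.
apply/polyP => i; rewrite coef_deriv coef_poly ltnS.
have [ip|pi] := ltnP i (size p).
  by rewrite -[LHS]mulr_natr divfK// pnatr_eq0.
by rewrite nth_default// mul0rn.
Qed.

Lemma antideriv0 p : (antideriv p).[0] = 0.
Proof. by rewrite horner_coef0 coef_poly/= invr0 mulr0. Qed.

Lemma size_antideriv p : (size (antideriv p) <= (size p).+1)%N.
Proof. exact: size_poly. Qed.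

(* The bound on |e^{it} - (p + i q)(t)| is expressed by all linear functionals
   of norm 1, so that the induction only needs monotonicity of real functions. *)
Lemma taylor_cos_sin (N : nat) : exists p q,
  [/\ (size p <= N)%N, (size q <= N)%N & forall t a b : R, a ^+ 2 + b ^+ 2 <= 1 ->
    a * (cos t - p.[t]) + b * (sin t - q.[t]) <= `|t| ^+ N / N`!%:R].
Proof.
elim: N => [|N [p [q [sp sq pq]]]].
  exists 0, 0; rewrite size_poly0; split => // t a b ab1.
  rewrite !horner0 !subr0 expr0 fact0 divr1.
  have := sqr_ge0 (a - cos t); have := sqr_ge0 (b - sin t).
  by have := cos2Dsin2 t; rewrite !sqrrB; nra.
(* These integrate the previous approximations: cos is 1 minus the integral of sin, and sin is the
   integral of cos. *)
exists (1 - antideriv q), (antideriv p); split.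
- rewrite (leq_trans (size_polyD _ _))// geq_max size_poly1 size_polyN.
  by rewrite (leq_trans (size_antideriv _)).
- by rewrite (leq_trans (size_antideriv _)).
(* The sign s of t reduces both half-lines to x >= 0 through t = s |t|. *)
move=> t a b ab1; pose s : R := if 0 <= t then 1 else -1.
have ts : t = s * `|t|.
  by rewrite /s; case: ger0P; rewrite ?mul1r// mulN1r opprK.
have s2 : s ^+ 2 = 1 by rewrite /s; case: ifP => _; rewrite ?expr1n ?sqrrN ?expr1n.
pose P : {poly R} := (N.+1`!%:R^-1)%:P * 'X^(N.+1) + a%:P * ((1 - antideriv q) \Po (s *: 'X)) +
  b%:P * (antideriv p \Po (s *: 'X)).
(* h(x) is the claimed bound at s x minus the functional, so the goal is h(|t|) >= 0; it follows
   from h(0) = 0 and h' >= 0 on the half-line. *)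
pose h : R -> R := horner P - (a \*: (cos \o ( *%R s))) - (b \*: (sin \o ( *%R s))).
have hE x : h x = P.[x] - a * cos (s * x) - b * sin (s * x) by [].
have PE x : P.[x] = N.+1`!%:R^-1 * x ^+ N.+1 + a * (1 - antideriv q).[s * x] +
    b * (antideriv p).[s * x].
  by rewrite /P !hornerE !horner_comp !hornerE.
pose dh x := (P^`()).[x] + a * (s * sin (s * x)) - b * (s * cos (s * x)).
have dhE (x : R) : is_derive x (1 : R) h (dh x).
  have ds : is_derive x (1 : R) ( *%R s) s.
    rewrite (_ : *%R s = s \*: (id : R -> R))//; apply: trigger_derive.
    by rewrite /GRing.scale/= mulr1.
  rewrite /h; apply: trigger_derive; rewrite /dh /GRing.scale/=; ring.
have dPE x : P^`().[x] = N`!%:R^-1 * x ^+ N - s * (a * q.[s * x]) + s * (b * p.[s * x]).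
  rewrite /P !(derivD, derivM, derivXn, derivC, mul0r, add0r) !deriv_comp.
  rewrite !(derivB, derivZ, derivX, derivC, sub0r, antiderivK).
  rewrite !hornerE !horner_comp !hornerE hornerMn hornerXn/= factS natrM invfM.
  have N0 : N.+1%:R != 0 :> R by rewrite pnatr_eq0.
  have NF0 : N`!%:R != 0 :> R by rewrite pnatr_eq0 -lt0n fact_gt0.
  rewrite -(mulr_natr (x ^+ N)); field.
  by apply/andP.
have dh0 x : 0 <= x -> 0 <= dh x.
  (* Differentiation turns the functional (a, b) by a right angle: h' >= 0 is the induction
     hypothesis for (s b, - s a), again in the unit disc. *)
  move=> x0; have := pq (s * x) (s * b) (- s * a).
  rewrite !exprMn sqrrN s2 !mul1r addrC => /(_ ab1).
  rewrite normrM (_ : `|s| = 1); last first.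
    by rewrite /s; case: ifP => _; rewrite ?normrN normr1.
  rewrite mul1r (ger0_norm x0) /dh dPE -subr_ge0 => H.
  by apply: le_trans H _; rewrite le_eqVlt; apply/orP; left; apply/eqP; ring.
have h0 : h 0 = 0.
  rewrite hE PE !mulr0 cos0 sin0 hornerD hornerN hornerC !antideriv0 expr0n/=.
  by ring.
have : h 0 <= h `|t|.
  apply: (@ger0_derive1_ndecry _ h 0) => //.
  - move=> x x0; rewrite derive1E (@derive_val _ _ _ _ _ _ _ (dhE x)) dh0//.
    by move: x0; rewrite in_itv/= andbT => /ltW.
  - apply: continuous_subspaceT => x; apply: differentiable_continuous.
    exact/derivable1_diffP.
rewrite h0 hE PE -ts -subr_ge0 subr0 => H; rewrite -subr_ge0.
by apply: le_trans H _; rewrite le_eqVlt; apply/orP; left; apply/eqP; ring.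
Qed.

Lemma taylor_expi (N : nat) : exists p : {poly R[i]}, (size p <= N)%N /\
  forall t : R, cabs (expi (- t) - p.[t%:C]) <= `|t| ^+ N / N`!%:R.
Proof.
have [p [q [sp sq pq]]] := taylor_cos_sin N.
exists (map_poly (real_complex R) p - 'i *: map_poly (real_complex R) q); split.
  rewrite (leq_trans (size_polyD _ _))// geq_max size_polyN.
  apply/andP; split; first by rewrite size_map_poly.
  by apply: leq_trans (size_scale_leq _ _) _; rewrite size_map_poly.
move=> t; set z := _ - _.
have zE : z = (cos t - p.[t]) -i* (sin t - q.[t]).
  rewrite /z /expi cosN sinN hornerD hornerN hornerZ !horner_map/=.
  by simpc; congr Complex; ring.
have cz : cabs z ^+ 2 = (cos t - p.[t]) ^+ 2 + (sin t - q.[t]) ^+ 2.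
  by rewrite cabs_sqE zE/= sqrrN.
have [z0|z0] := eqVneq (cabs z) 0; first by rewrite z0 divr_ge0 ?exprn_ge0.
(* The unit functional in the direction of the error takes the value |z| on it; z = 0 was set aside
   because of this division. *)
have := pq t ((cos t - p.[t]) / cabs z) ((sin t - q.[t]) / cabs z).
rewrite !expr_div_n -mulrDl -cz divff ?expf_neq0// => /(_ (lexx _)).
rewrite (_ : _ + _ = ((cos t - p.[t]) ^+ 2 + (sin t - q.[t]) ^+ 2) / cabs z).
  by rewrite -cz expr2 mulfK.
by ring.
Qed.

End TaylorExpi.

(** * The push-forward measure and its polynomial least squares problem *)

Section RestrictedIntegrals.
Context d (T : measurableType d) (R : realType).
Variable mu : {measure set T -> \bar R}.
Implicit Types (D : set T).
Local Notation C := R[i].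

Lemma ge0_integral_mrestr D (mD : measurable D) (f : T -> \bar R) :
  measurable_fun [set: T] f -> (forall x, 0 <= f x)%E ->
  (\int[mrestr mu mD]_x f x = \int[mu]_(x in D) f x)%E.
Proof.
move=> mf f0; rewrite (@ge0_negligible_integral _ _ _ _ setT (~` D))//.
- rewrite setTD setCK; apply: eq_measure_integral => X mX XD.
  by rewrite /= /mrestr setIidl.
- exact: measurableC.
- by rewrite /= /mrestr setICl measure0.
Qed.

Lemma integral_indic_restrict D (f : T -> R) :
  (\int[mu]_(x in D) (f x)%:E = \int[mu]_x (\1_D x * f x)%:E)%E.
Proof.
rewrite integral_mkcond; apply: eq_integral => x _.
by rewrite epatch_indic/= -EFinM mulrC.
Qed.

Lemma integrable_indic_bounded D (f : T -> R) (M : R) :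
  measurable D -> (mu D < +oo)%E -> measurable_fun [set: T] f ->
  (forall x, D x -> `|f x| <= M) ->
  mu.-integrable [set: T] (fun x => (\1_D x * f x)%:E).
Proof.
move=> mD Doo mf fM.
have : mu.-integrable D (EFin \o f).
  apply: measurable_bounded_integrable => //; first exact: measurable_funTS.
  by exists M; split; [exact: num_real | move=> N MN x /= Dx; rewrite (le_trans (fM _ Dx))// ltW].
move/(integrable_mkcond _ mD).
rewrite [X in _.-integrable _ X -> _](_ : _ = (fun x => (\1_D x * f x)%:E))//.
by apply/funext => x; rewrite epatch_indic/= -EFinM mulrC.
Qed.

Lemma cmeasurable_indicM D (g : T -> C) : measurable D -> cmeasurable g ->
  cmeasurable (fun x => (\1_D x : R)%:C * g x).
Proof.
by move=> mD mg; apply: cmeasurableM => //; exact: cmeasurable_real.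
Qed.

Lemma cabs_indicM D (g : T -> C) x :
  cabs ((\1_D x : R)%:C * g x) ^+ 2 = \1_D x * cabs (g x) ^+ 2.
Proof.
rewrite cabsM exprMn (cabs_sqE (_%:C)) [complex.Re _]/= [complex.Im _]/= indicE.
rewrite expr0n/= addr0.
by case: (_ \in _); rewrite ?expr1n ?expr0n.
Qed.

Lemma cL2_indic_bounded D (g : T -> C) (M : R) :
  measurable D -> (mu D < +oo)%E -> cmeasurable g ->
  (forall x, D x -> cabs (g x) ^+ 2 <= M) ->
  cL2 mu (fun x => (\1_D x : R)%:C * g x).
Proof.
move=> mD Doo mg gM.
have i : mu.-integrable setT (fun x => (\1_D x * cabs (g x) ^+ 2)%:E).
  apply: (@integrable_indic_bounded D _ M) => //; first exact: cmeasurable_cabs.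
  by move=> x Dx; rewrite ger0_norm ?sqr_ge0// gM.
apply: cL2_le i _; first exact: cmeasurable_indicM.
by move=> x; rewrite cabs_indicM.
Qed.

End RestrictedIntegrals.

Section ProductIntegral.
Context d1 d2 (T1 : measurableType d1) (T2 : measurableType d2) (R : realType).
Variables (m1 : {sigma_finite_measure set T1 -> \bar R})
  (m2 : {sigma_finite_measure set T2 -> \bar R}).

Lemma Rintegral_prod (u : T1 -> R) (v : T2 -> R) :
  m1.-integrable [set: T1] (EFin \o u) -> m2.-integrable [set: T2] (EFin \o v) ->
  (m1 \x m2)%E.-integrable [set: T1 * T2] (fun z => (u z.1 * v z.2)%:E) ->
  fine (\int[m1 \x m2]_z (u z.1 * v z.2)%:E)%E =
  (\int[m1]_x u x) * (\int[m2]_y v y).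
Proof.
move=> iu iv iuv; rewrite -integral12_prod_meas1//.
rewrite (eq_integral (fun x => (u x)%:E * (\int[m2]_y (v y)%:E))%E); last first.
  by move=> x _; rewrite /fubini_F/= -integralZl.
have fv : (\int[m2]_y (v y)%:E)%E \is a fin_num by exact: integrable_fin_num.
have fu : (\int[m1]_y (u y)%:E)%E \is a fin_num by exact: integrable_fin_num.
by rewrite -(fineK fv) integralZr// -(fineK fu) -EFinM.
Qed.

End ProductIntegral.

Section ScaledSets.
Context (R : realType).
Local Notation leb := (@completed_lebesgue_measure R).

Lemma bounded_setP (E : set R) : bounded_set E ->
  exists2 M, 0 <= M & forall x, E x -> `|x| <= M.
Proof.
move=> [M [_ EM]]; exists (`|M| + 1); first by rewrite addr_ge0.
by move=> x Ex; apply: EM => //; rewrite (le_lt_trans (ler_norm _))// ltrDl.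
Qed.

Lemma bounded_scale_set (c : R) (B : set R) : 0 < c ->
  bounded_set B -> bounded_set (scale_set c B).
Proof.
move=> c_gt0 /bounded_setP[M M0 BM].
exists (c * M); split; first exact: num_real.
move=> N MN _ [w Bw <-] /=; rewrite normrM (gtr0_norm c_gt0).
by rewrite (le_trans _ (ltW MN))// ler_wpM2l ?BM// ltW.
Qed.

Lemma leb_scale_fin (c : R) (B : set R) : 0 < c ->
  (leb (B : set (lebR R)) < +oo)%E ->
  (leb (scale_set c B : set (lebR R)) < +oo)%E.
Proof.
move=> c_gt0 finB; rewrite leb_scale//.
rewrite -(fineK (_ : leb B \is a fin_num)) -?EFinM ?ltry//.
by rewrite ge0_fin_numE.
Qed.

Lemma indic_setX (T1 T2 : Type) (X : set T1) (Y : set T2) x y :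
  \1_(X `*` Y) (x, y) = \1_X x * \1_Y y :> R.
Proof.
rewrite !indicE -natrM mulnb; congr (nat_of_bool _)%:R.
by apply/idP/andP => [/set_mem[/= ? ?]|[/set_mem ? /set_mem ?]]; [split|]; rewrite inE.
Qed.

End ScaledSets.

(** * The push-forward measure of the phase *)

Section PhasePush.
Context (R : realType).
Local Notation C := R[i].
Local Notation leb := (@completed_lebesgue_measure R).
Variables (A B : set R) (c alpha beta : R).
Hypotheses (mA : lebesgue_measurable A) (mB : lebesgue_measurable B).
Hypotheses (bA : bounded_set A) (bB : bounded_set B).
Hypotheses (finA : (leb (A : set (lebR R)) < +oo)%E).
Hypotheses (finB : (leb (B : set (lebR R)) < +oo)%E).
Hypothesis c_gt0 : 0 < c.

Let cB := scale_set c B.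
Let D : set (lebR R * lebR R) := A `*` cB.
Let t := @tmap R c alpha beta.

Lemma measurable_scaled_rect : measurable D.
Proof. by apply: measurableX => //; exact: measurable_scale_set. Qed.

Let cB_fin : (leb (cB : set (lebR R)) < +oo)%E.
Proof. exact: leb_scale_fin. Qed.

Lemma leb2_scaled_rect : ((leb \x leb)%E D < +oo)%E.
Proof.
rewrite /= product_measure1E//; last exact: measurable_scale_set.
by rewrite lte_mul_pinfty// ge0_fin_numE.
Qed.

Lemma measurable_tmap :
  measurable_fun [set: lebR R * lebR R] (t : _ -> measurableTypeR R).
Proof.
suff mt : measurable_fun [set: lebR R * lebR R] (t : _ -> R) by exact: mt.
have m1 : measurable_fun [set: lebR R * lebR R] (fun z => z.1 : R).
  exact: measurableT_comp (@measurable_id_leb R) measurable_fst.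
have m2 : measurable_fun [set: lebR R * lebR R] (fun z => z.2 : R).
  exact: measurableT_comp (@measurable_id_leb R) measurable_snd.
by apply: measurable_funM; [apply: measurable_funM => // |]; exact: measurable_funB.
Qed.

Lemma tmap_bounded : exists2 M, 0 <= M & forall z, D z -> `|t z| <= M.
Proof.
have [M M0 AM] := bounded_setP bA; have [M' M'0 BM] := bounded_setP bB.
have p0 : 0 <= 2 * pi :> R by rewrite mulr_ge0// pi_ge0.
have Ma : 0 <= M + `|alpha| by rewrite addr_ge0.
have Mb : 0 <= c * (M' + `|beta|) by rewrite mulr_ge0 ?addr_ge0 ?(ltW c_gt0).
exists (2 * pi * (M + `|alpha|) * (c * (M' + `|beta|))).
  by rewrite mulr_ge0// mulr_ge0.
move=> [x y] [/= Ax [w Bw <-]]; rewrite /t /tmap/= -mulrBr normrM.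
rewrite (normrM c) (gtr0_norm c_gt0) (normrM (2 * pi)) (ger0_norm p0).
apply: ler_pM; [exact: mulr_ge0|by rewrite mulr_ge0// ltW| |].
- by rewrite ler_wpM2l// (le_trans (ler_normB _ _))// lerD2r AM.
- by rewrite ler_wpM2l ?(ltW c_gt0)// (le_trans (ler_normB _ _))// lerD2r BM.
Qed.

(** The same set function as [nu], packaged as a measure: [mrestr] measures the intersection with
    the rectangle, which makes [nuE] hold by conversion. *)
Definition nu_measure : {measure set (measurableTypeR R) -> \bar R} :=
  measure_function_pushforward__canonical__measure_function_Measure
    (mrestr (leb \x leb)%E measurable_scaled_rect) measurable_tmap.

Lemma nuE : nu A B c alpha beta = nu_measure.
Proof. by rewrite /nu. Qed.

Lemma ge0_integral_nu (f : R -> \bar R) :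
  measurable_fun [set: measurableTypeR R] f -> (forall x, 0 <= f x)%E ->
  (\int[nu_measure]_x f x = \int[leb \x leb]_(z in D) f (t z))%E.
Proof.
move=> mf f0.
have E := @ge0_integral_pushforward _ _ _ _ R _ measurable_tmap
  (mrestr (leb \x leb)%E measurable_scaled_rect) setT f measurableT mf (fun x _ => f0 x).
rewrite preimage_setT in E; rewrite /nu_measure [LHS]E.
apply: ge0_integral_mrestr; last by move=> z; exact: f0.
exact: measurableT_comp mf measurable_tmap.
Qed.

Lemma integral_nu (f : R -> R) : measurable_fun [set: measurableTypeR R] f ->
  (\int[nu A B c alpha beta]_x (f x)%:E =
   \int[leb \x leb]_z (\1_D z * f (t z))%:E)%E.
Proof.
move=> mf; transitivity (\int[leb \x leb]_(z in D) (f (t z))%:E)%E;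
  last exact: integral_indic_restrict.
rewrite nuE (integralE nu_measure setT (fun x => (f x)%:E)).
rewrite (integralE (leb \x leb)%E D (fun z => (f (t z))%:E)).
have mf' : measurable_fun [set: measurableTypeR R] (fun x => (f x)%:E).
  exact/measurable_EFinP.
congr (_ - _)%E.
  rewrite ge0_integral_nu; [|exact: measurable_funepos|exact: funepos_ge0].
  by apply: eq_integral => z _; rewrite !funeposE.
rewrite ge0_integral_nu; [|exact: measurable_funeneg|exact: funeneg_ge0].
by apply: eq_integral => z _; rewrite !funenegE.
Qed.

End PhasePush.

(** * Best polynomial approximation in L^2 of the push-forward *)

Section PhaseLeastSquares.
Context (R : realType).
Local Notation C := R[i].
Local Notation leb := (@completed_lebesgue_measure R).

Lemma expiD (u v : R) : expi (u + v) = expi u * expi v.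
Proof.
by rewrite /expi cosD sinD; simpc; congr Complex; rewrite addrC [X in _ + X]mulrC.
Qed.

Lemma cabs_expi (u : R) : cabs (expi u) ^+ 2 = 1.
Proof. by rewrite cabs_sqE cos2Dsin2. Qed.

Lemma cmeasurable_expi d (T : measurableType d) (u : T -> R) :
  measurable_fun [set: T] u -> cmeasurable (fun x => expi (u x)).
Proof.
move=> mu; split => /=.
  exact: measurableT_comp (continuous_measurable_fun (@continuous_cos R)) mu.
exact: measurableT_comp (continuous_measurable_fun (@continuous_sin R)) mu.
Qed.

Lemma horner_sum_lt (p : {poly C}) N x : (size p <= N)%N ->
  p.[x] = \sum_(j < N) p`_j * x ^+ j.
Proof. exact: horner_coef_wide. Qed.

Variables (A B : set R) (c alpha beta : R).
Hypotheses (mA : lebesgue_measurable A) (mB : lebesgue_measurable B).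
Hypotheses (bA : bounded_set A) (bB : bounded_set B).
Hypotheses (finA : (leb (A : set (lebR R)) < +oo)%E).
Hypotheses (finB : (leb (B : set (lebR R)) < +oo)%E).
Hypothesis c_gt0 : 0 < c.

Let D : set (lebR R * lebR R) := A `*` scale_set c B.
Let t := @tmap R c alpha beta.
Let nuM := nu_measure alpha beta mA mB c_gt0.

Lemma cmeasurable_comp_tmap (f : measurableTypeR R -> C) :
  cmeasurable f -> cmeasurable (fun z : lebR R * lebR R => f (t z)).
Proof.
move=> [f1 f2]; split.
- exact: measurableT_comp f1 (measurable_tmap c alpha beta).
- exact: measurableT_comp f2 (measurable_tmap c alpha beta).
Qed.

Lemma integral_normsq_nu (f : measurableTypeR R -> C) : cmeasurable f ->
  (\int[nuM]_s (cabs (f s) ^+ 2)%:E =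
   \int[leb \x leb]_z (cabs ((\1_D z : R)%:C * f (t z)) ^+ 2)%:E)%E.
Proof.
move=> mf; have mf2 := cmeasurable_cabs mf.
apply: etrans (_ : _ = (\int[leb \x leb]_z (\1_D z * cabs (f (t z)) ^+ 2)%:E)%E) _.
  by rewrite -(integral_nu alpha beta mA mB c_gt0 mf2) (nuE alpha beta mA mB c_gt0).
by apply: eq_integral => z _; rewrite (cabs_indicM D (fun z => f (t z))).
Qed.

Lemma normsq_nu (f : measurableTypeR R -> C) : cmeasurable f ->
  normsq nuM f = normsq (leb \x leb)%E (fun z => (\1_D z : R)%:C * f (t z)).
Proof. by move=> mf; rewrite /normsq integral_normsq_nu. Qed.

(** [K M] bounds |f|^2 on [-M, M]. As A and B are bounded, so is the phase on the rectangle, and one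
    such M captures all the mass. *)
Lemma cL2_nu (f : measurableTypeR R -> C) (K : R -> R) : cmeasurable f ->
  (forall M s, `|s| <= M -> cabs (f s) ^+ 2 <= K M) -> cL2 nuM f.
Proof.
move=> mf fK; split => //; rewrite integral_normsq_nu//.
have [M M0 tM] := tmap_bounded alpha beta bA bB c_gt0.
have mD := measurable_scaled_rect mA mB c_gt0.
have Doo := leb2_scaled_rect mA mB finA finB c_gt0.
apply: (proj2 (@cL2_indic_bounded _ _ _ (leb \x leb)%E D _ (K M) mD Doo _ _)).
  exact: cmeasurable_comp_tmap.
by move=> z Dz; apply: fK; exact: tM.
Qed.

Let e (s : R) := expi (- s).
Let mon N (j : 'I_N) (s : R) : C := (s ^+ j)%:C.

Lemma cL2_nu_expi : cL2 nuM e.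
Proof.
apply: (@cL2_nu _ (fun=> 1)); last by move=> M s _; rewrite cabs_expi.
by apply: cmeasurable_expi; exact: oppr_measurable.
Qed.

Lemma cL2_nu_mon N (j : 'I_N) : cL2 nuM (mon j).
Proof.
apply: (@cL2_nu _ (fun M => (M ^+ j) ^+ 2)).
  by apply: cmeasurable_real; exact: exprn_measurable.
move=> M s sM; rewrite cabs_sqE [complex.Re _]/= [complex.Im _]/= expr0n addr0.
have M0 : 0 <= M by exact: le_trans (normr_ge0 _) sM.
rewrite -(real_normK (num_real (s ^+ j))) normrX lerXn2r ?nnegrE ?exprn_ge0//.
by rewrite lerXn2r ?nnegrE.
Qed.

Lemma cL2_nu_poly (p : {poly C}) : cL2 nuM (fun s : R => p.[s%:C]).
Proof.
rewrite (_ : (fun s => _) = fun s : R => \sum_(j < size p) p`_j * mon j s).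
  by apply: cL2_sum => j; apply: cL2Z; exact: cL2_nu_mon.
apply/funext => s; rewrite (horner_sum_lt _ (leqnn _)).
by apply: eq_bigr => j _; rewrite /mon rmorphXn.
Qed.

Lemma residual_sqE (p : {poly C}) N : (size p <= N)%N ->
  residual_sq A B c alpha beta p =
  normsq nuM (fun s => e s - \sum_(j < N) p`_j * mon j s).
Proof.
move=> pN; rewrite /residual_sq (nuE alpha beta mA mB c_gt0) /normsq.
congr fine; apply: eq_integral => s _.
suff -> : p.[s%:C] = \sum_(j < N) p`_j * mon j s by [].
rewrite (horner_sum_lt _ pN).
by apply: eq_bigr => j _; rewrite /mon rmorphXn.
Qed.

Lemma gramE N : gram A B c alpha beta N =
  \matrix_(j, k) cinner nuM (mon k) (mon j).
Proof.
apply/matrixP => j k; rewrite !mxE /gram_entry /cinner /cint.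
rewrite (nuE alpha beta mA mB c_gt0).
have monM s : mon k s * (mon j s)^* = (s ^+ (j + k))%:C.
  apply: etrans (_ : _ = (s ^+ k)%:C * (s ^+ j)%:C) _; last first.
    by rewrite -rmorphM -exprD addnC.
  by congr (_ * _); exact: conjc_real.
congr Complex; first by congr (@fine R); apply: eq_integral => s _; rewrite monM.
rewrite (eq_integral (fun=> 0%E)); first by rewrite integral0.
by move=> s _; rewrite monM.
Qed.

Lemma bvecE N : bvec A B c alpha beta N = \col_j cinner nuM e (@mon N j).
Proof.
apply/matrixP => j k; rewrite [LHS]mxE [RHS]mxE (nuE alpha beta mA mB c_gt0) /cinner.
congr cint; apply/funext => s; rewrite /mon mulrC; congr (_ * _).
exact/esym/conjc_real.
Qed.

Lemma normsq_nu_expi :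
  normsq nuM e = c * fine (leb (A : set (lebR R))) * fine (leb (B : set (lebR R))).
Proof.
have mD := measurable_scaled_rect mA mB c_gt0.
rewrite normsq_nu ?cL2_nu_expi.1// /normsq; last exact: cL2_nu_expi.1.
rewrite (eq_integral (fun z => (\1_D z : R)%:E)); last first.
  by move=> z _; rewrite (cabs_indicM D (fun z => e (t z))) cabs_expi mulr1.
have fA : leb (A : set (lebR R)) \is a fin_num by rewrite ge0_fin_numE.
have fB : leb (B : set (lebR R)) \is a fin_num by rewrite ge0_fin_numE.
rewrite integral_indic// setIT /= product_measure1E//; last exact: measurable_scale_set.
apply: etrans (_ : _ = fine (leb (A : set (lebR R)) * (c%:E * leb (B : set (lebR R))))%E) _.
  by congr (fine (_ * _)%E); exact: leb_scale.
by rewrite !fineM ?fin_numM//= mulrCA mulrA.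
Qed.

(** [insub] recovers the ordinal that indexes the column vector; it succeeds for every j < N, so the
    default 0 is never read. *)
Definition best_poly N : {poly C} :=
  \poly_(j < N) (if insub j is Some i then
    (mp_inverse (gram A B c alpha beta N) *m bvec A B c alpha beta N) i ord0
   else 0).

Lemma size_best_poly N : (size (best_poly N) <= N)%N.
Proof. exact: size_poly. Qed.

Lemma coef_best_poly N (j : 'I_N) : (best_poly N)`_j =
  (mp_inverse (gram A B c alpha beta N) *m bvec A B c alpha beta N) j ord0.
Proof. by rewrite coef_poly ltn_ord insubT//= => jN; congr (_ _ _); exact: val_inj. Qed.

Lemma residual_sq_best N : residual_sq A B c alpha beta (best_poly N) =
  normsq nuM (fun s => e s - \sum_(j < N)
    (mp_inverse (\matrix_(j < N, k < N) cinner nuM (mon k) (mon j)) *m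
      \col_(j < N) cinner nuM e (mon j)) j ord0 * mon j s).
Proof.
rewrite (residual_sqE (size_best_poly N)) -gramE -bvecE.
by under eq_fun do under eq_bigr do rewrite coef_best_poly.
Qed.

Lemma residual_sq_best_min N (p : {poly C}) : (size p <= N)%N ->
  residual_sq A B c alpha beta (best_poly N) <= residual_sq A B c alpha beta p.
Proof.
move=> pN; rewrite residual_sq_best (residual_sqE pN).
exact: (least_squares_min (@cL2_nu_mon N) cL2_nu_expi).
Qed.

Lemma residual_sq_ge0 (p : {poly C}) : 0 <= residual_sq A B c alpha beta p.
Proof. by rewrite (residual_sqE (leqnn _)) normsq_ge0. Qed.

(** The infimum is a minimum, attained at the solution of the normal equations; the zero polynomial,
    of size 0, shows that there are values to take it over, for N = 0 as well. *)
Lemma poly_residual_sq N : poly_residual A B c alpha beta N ^+ 2 =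
  residual_sq A B c alpha beta (best_poly N).
Proof.
rewrite sqr_sqrtr; last first.
  apply: lb_le_inf => [|_ [p _ <-]]; last exact: residual_sq_ge0.
  by exists (residual_sq A B c alpha beta 0), 0 => //=; rewrite /poly_below/= size_poly0.
apply/eqP; rewrite eq_le; apply/andP; split.
  apply: ge_inf; last by exists (best_poly N) => //; exact: size_best_poly.
  by exists 0 => _ [p _ <-]; exact: residual_sq_ge0.
apply: lb_le_inf => [|_ [p pN <-]]; last exact: residual_sq_best_min.
by exists (residual_sq A B c alpha beta 0), 0 => //=; rewrite /poly_below/= size_poly0.
Qed.

Lemma poly_residual_gram N : (poly_residual A B c alpha beta N ^+ 2)%:C =
  (c * fine (leb (A : set (lebR R))) * fine (leb (B : set (lebR R))))%:C -
  (ctrans (bvec A B c alpha beta N) *m mp_inverse (gram A B c alpha beta N) *m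
   bvec A B c alpha beta N) ord0 ord0.
Proof.
rewrite poly_residual_sq residual_sq_best.
rewrite (least_squares_value (@cL2_nu_mon N) cL2_nu_expi) normsq_nu_expi.
by rewrite -gramE -bvecE.
Qed.

End PhaseLeastSquares.

(** * The Fourier kernel and its finite rank approximations *)

Section FourierKernel.
Context (R : realType).
Local Notation C := R[i].
Local Notation leb := (@completed_lebesgue_measure R).
Variables (A B : set R) (c alpha beta : R).
Hypotheses (mA : lebesgue_measurable A) (mB : lebesgue_measurable B).
Hypotheses (bA : bounded_set A) (bB : bounded_set B).
Hypotheses (finA : (leb (A : set (lebR R)) < +oo)%E).
Hypotheses (finB : (leb (B : set (lebR R)) < +oo)%E).
Hypothesis c_gt0 : 0 < c.

Let cB := scale_set c B.
Let D : set (lebR R * lebR R) := A `*` cB.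
Let t := @tmap R c alpha beta.

Let indicD x y : \1_D (x, y) = \1_A x * \1_cB y :> R.
Proof. exact: indic_setX. Qed.

Let bounded_cB : bounded_set cB.
Proof. exact: bounded_scale_set. Qed.

Let cB_fin : (leb (cB : set (lebR R)) < +oo)%E.
Proof. exact: leb_scale_fin. Qed.

(** All sections are under control: for y in cB the section is the indicator of A times a function
    bounded on A, and otherwise it is 0. *)
Lemma hs_kernel_indic (g : lebR R * lebR R -> C) (M : R) : cmeasurable g ->
  (forall z, D z -> cabs (g z) ^+ 2 <= M) ->
  hs_kernel leb (fun z => (\1_D z : R)%:C * g z).
Proof.
move=> mg gM; split.
  apply: (cL2_indic_bounded (M := M)) => //; first exact: measurable_scaled_rect.
  exact: leb2_scaled_rect.
move=> y; have mgy : cmeasurable (fun x : lebR R => g (x, y)).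
  by have [g1 g2] := mg; split; [exact: (measurable_fun_pair1 y g1) |
    exact: (measurable_fun_pair1 y g2)].
have [yB|yB] := pselect (cB y).
  rewrite (_ : (fun x => _) = (fun x => (\1_A x : R)%:C * g (x, y))).
    by apply: (cL2_indic_bounded (M := M)) => // x Ax; exact: gM.
  by apply/funext => x; rewrite indicD [\1_cB y]indicE mem_set// mulr1.
rewrite (_ : (fun x => _) = (fun=> 0)); first exact: cL2_0.
by apply/funext => x; rewrite indicD [\1_cB y]indicE memNset// mulr0 mul0r.
Qed.

Let mfst : measurable_fun [set: lebR R * lebR R] (fun z => z.1 : R).
Proof. exact: measurableT_comp (@measurable_id_leb R) measurable_fst. Qed.
Let msnd : measurable_fun [set: lebR R * lebR R] (fun z => z.2 : R).
Proof. exact: measurableT_comp (@measurable_id_leb R) measurable_snd. Qed.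

Definition fourier_kernel (z : lebR R * lebR R) : C :=
  (\1_D z : R)%:C * expi (- (2 * pi * z.1 * z.2)).

Lemma hs_fourier_kernel : hs_kernel leb fourier_kernel.
Proof.
apply: (@hs_kernel_indic _ 1); last by move=> z _; rewrite cabs_expi.
apply: cmeasurable_expi; apply: measurable_funN; apply: measurable_funM => //.
exact: measurable_funM.
Qed.

(** Equality at every point: off cB both sides vanish. *)
Lemma Kop_kernel f : Kop A B c f = kernel_op leb fourier_kernel f.
Proof.
apply/funext => y; rewrite /Kop /indic_mul /fourier /kernel_op.
have [yB|yB] := pselect (cB y); rewrite indicE.
  rewrite mem_set// mul1r; congr cint; apply/funext => x.
  by rewrite /fourier_kernel indicD [\1_cB y]indicE mem_set// mulr1 mulrCA mulrA.
rewrite memNset// mul0r -[LHS](cint0 leb); congr cint; apply/funext => x.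
by rewrite /fourier_kernel indicD [\1_cB y]indicE memNset// mulr0 !mul0r.
Qed.

(* 2 pi x xi = t_{alpha,beta}(x, xi) + 2 pi c beta x + 2 pi alpha (xi - c beta) *)
Let phx (x : R) := expi (- (2 * pi * c * beta * x)).
Let phy (y : R) := expi (- (2 * pi * alpha * (y - c * beta))).

Let fourier_kernelE z :
  fourier_kernel z = phx z.1 * phy z.2 * ((\1_D z : R)%:C * expi (- t z)).
Proof.
rewrite mulrCA /fourier_kernel /phx /phy -!expiD; congr (_ * expi _).
by rewrite /t /tmap; ring.
Qed.

Variables (p : {poly C}) (N : nat).
Hypothesis pN : (size p <= N)%N.

Definition approx_kernel (z : lebR R * lebR R) : C :=
  phx z.1 * phy z.2 * ((\1_D z : R)%:C * p.[(t z)%:C]).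

Definition approx_out (j : 'I_N) (y : R) : C :=
  (\1_cB y : R)%:C * (phy y * (p`_j * ((2 * pi * (y - c * beta)) ^+ j)%:C)).

Definition approx_in (j : 'I_N) (x : R) : C :=
  (\1_A x : R)%:C * (phx x * ((x - alpha) ^+ j)%:C).

(** Each power t^j separates as (2 pi (y - c beta))^j (x - alpha)^j and the phases separate too, so
    every coefficient of p costs one rank. *)
Lemma approx_kernel_sum x y :
  approx_kernel (x, y) = \sum_(j < N) approx_out j y * approx_in j x.
Proof.
rewrite /approx_kernel (horner_sum_lt _ pN) !mulr_sumr; apply: eq_bigr => j _.
rewrite indicD /approx_in /approx_out /t /tmap/= -rmorphXn/=.
rewrite [2 * pi * (x - alpha) * _]mulrAC exprMn !rmorphM/=; ring.
Qed.

Let mid : measurable_fun [set: lebR R] (fun x : lebR R => x : R).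
Proof. exact: measurable_id_leb. Qed.

Let msub (a : R) : measurable_fun [set: lebR R] (fun x : lebR R => (x : R) - a).
Proof. exact: measurable_funB mid (measurable_cst _). Qed.

Let mphx : cmeasurable (phx : lebR R -> C).
Proof.
apply: (@cmeasurable_expi R _ (lebR R)); apply: measurable_funN.
exact: measurable_funM (measurable_cst _) mid.
Qed.

Let mphy : cmeasurable (phy : lebR R -> C).
Proof.
apply: (@cmeasurable_expi R _ (lebR R)); apply: measurable_funN.
exact: measurable_funM (measurable_cst _) (msub _).
Qed.

Lemma cL2_approx_in j : cL2 leb (approx_in j).
Proof.
have [M M0 AM] := bounded_setP bA.
apply: (@cL2_indic_bounded _ (lebR R) _ leb A
  (fun x => phx x * (((x : R) - alpha) ^+ j)%:C) (((M + `|alpha|) ^+ j) ^+ 2) mA finA).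
  apply: (cmeasurableM mphx).
  by apply: cmeasurable_real; exact: measurable_funX (msub _).
move=> x Ax; rewrite cabsM exprMn cabs_expi mul1r.
rewrite cabs_sqE [complex.Re _]/= [complex.Im _]/= expr0n addr0.
rewrite -(real_normK (num_real (_ ^+ j))) normrX.
rewrite lerXn2r ?nnegrE ?exprn_ge0 ?addr_ge0// lerXn2r ?nnegrE ?addr_ge0//.
by rewrite (le_trans (ler_normB _ _))// lerD2r AM.
Qed.

Lemma cL2_approx_out j : cL2 leb (approx_out j).
Proof.
have [M M0 AM] := bounded_setP bounded_cB.
have p0 : 0 <= 2 * pi :> R by rewrite mulr_ge0// pi_ge0.
apply: (@cL2_indic_bounded _ (lebR R) _ leb cB
  (fun y => phy y * (p`_j * ((2 * pi * ((y : R) - c * beta)) ^+ j)%:C))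
  (cabs (p`_j) ^+ 2 * ((2 * pi * (M + `|c * beta|)) ^+ j) ^+ 2)
  (measurable_scale_set c_gt0 mB) cB_fin).
- apply: (cmeasurableM mphy); apply: cmeasurableM; first exact: cmeasurable_cst.
  apply: cmeasurable_real; apply: measurable_funX.
  exact: measurable_funM (measurable_cst _) (msub _).
move=> y By; rewrite cabsM exprMn cabs_expi mul1r cabsM exprMn ler_wpM2l ?sqr_ge0//.
rewrite cabs_sqE [complex.Re _]/= [complex.Im _]/= expr0n addr0.
rewrite -(real_normK (num_real (_ ^+ j))) normrX.
have b0 : 0 <= 2 * pi * (M + `|c * beta|) by rewrite mulr_ge0// addr_ge0.
rewrite lerXn2r ?nnegrE ?exprn_ge0// lerXn2r ?nnegrE//.
rewrite normrM (ger0_norm p0) ler_wpM2l//.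
by rewrite (le_trans (ler_normB _ _))// lerD2r AM.
Qed.

Let nuM := nu_measure alpha beta mA mB c_gt0.

Let pnu (s : measurableTypeR R) : C := p.[(s : R)%:C].

Let pnu2 : cL2 nuM pnu.
Proof. exact: (@cL2_nu_poly R A B c alpha beta mA mB bA bB finA finB c_gt0). Qed.

Let cabs_phases z (w : C) : cabs (phx z.1 * phy z.2 * w) ^+ 2 = cabs w ^+ 2.
Proof. by rewrite !cabsM !exprMn !cabs_expi !mul1r. Qed.

Lemma hs_approx_kernel : hs_kernel leb approx_kernel.
Proof.
have h2 y : cL2 leb (fun x => approx_kernel (x, y)).
  rewrite (_ : (fun x => _) = fun x => \sum_(j < N) approx_out j y * approx_in j x).
    by apply: cL2_sum => j; apply: cL2Z; exact: cL2_approx_in.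
  by apply/funext => x; exact: approx_kernel_sum.
split; last exact: h2.
split.
  apply: cmeasurableM; last first.
    apply: cmeasurable_indicM; first exact: measurable_scaled_rect.
    exact: (cmeasurable_comp_tmap c alpha beta pnu2.1).
  by apply: cmeasurableM; [have [m1 m2] := mphx | have [m1 m2] := mphy]; split;
    [exact: measurableT_comp m1 measurable_fst
    |exact: measurableT_comp m2 measurable_fst
    |exact: measurableT_comp m1 measurable_snd
    |exact: measurableT_comp m2 measurable_snd].
under eq_integral do rewrite cabs_phases.
by rewrite -(integral_normsq_nu alpha beta mA mB c_gt0 pnu2.1); exact: pnu2.2.
Qed.

Lemma kernel_op_approx f y : cL2 leb f -> kernel_op leb approx_kernel f y =
  \sum_(j < N) approx_out j y * cinner leb f (fun x => (approx_in j x)^*).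
Proof.
move=> f2; have ain2 j : cL2 leb (fun x => (approx_in j x)^*).
  by apply: cL2_conj; exact: cL2_approx_in.
rewrite kernel_op_inner.
rewrite (_ : (fun x => _) =
    fun x => \sum_(j < N) (approx_out j y)^* * (approx_in j x)^*).
  rewrite (cinner_sumr _ (fun j => (approx_out j y)^*) ain2)//.
  by apply: eq_bigr => j _; congr (_ * _); exact: conjcK.
apply/funext => x; rewrite approx_kernel_sum rmorph_sum.
by apply: eq_bigr => j _; rewrite rmorphM.
Qed.

Lemma rank_approx : rank_at_most (kernel_op leb approx_kernel) N.
Proof.
exists approx_out; split=> [j|f /L2P f2]; first exact/L2P/cL2_approx_out.
exists (fun j => cinner leb f (fun x => (approx_in j x)^*)); apply: aeW => y.
by rewrite (kernel_op_approx y f2); apply: eq_bigr => j _; rewrite mulrC.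
Qed.

Lemma normsq_kernel_diff :
  normsq (leb \x leb)%E (fun z => fourier_kernel z - approx_kernel z) =
  residual_sq A B c alpha beta p.
Proof.
have enu2 := cL2_nu_expi alpha beta mA mB bA bB finA finB c_gt0.
have [mf _] := cL2B enu2 pnu2.
rewrite /residual_sq (nuE alpha beta mA mB c_gt0).
rewrite -[RHS]/(normsq nuM (fun s : R => expi (- s) - pnu s)) normsq_nu//.
congr fine; apply: eq_integral => z _.
rewrite fourier_kernelE /approx_kernel -mulrBr cabs_phases -mulrBr.
by [].
Qed.

Lemma singular_value_residual (r : R) : 0 <= r ->
  residual_sq A B c alpha beta p <= r ^+ 2 ->
  (singular_value (Kop A B c) N.+1 <= r%:E)%E.
Proof.
move=> r0 pr.
have Kk f : L2 f -> Kop A B c f = kernel_op leb fourier_kernel f.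
  by move=> _; exact: Kop_kernel.
(* [kernel_op] integrates without a conjugate, so the functionals to be annihilated are inner
   products with the conjugates of the [approx_in j]. *)
have in2 j : cL2 leb (fun x => (approx_in j x)^*).
  by apply: cL2_conj; exact: cL2_approx_in.
have in0 f : L2 f -> (forall j, cinner leb f (fun x => (approx_in j x)^*) = 0) ->
    forall y, kernel_op leb approx_kernel f y = 0.
  move=> /L2P f2 f0 y; rewrite (kernel_op_approx y f2) big1// => j _.
  by rewrite f0 mulr0.
apply: (singular_value_le hs_fourier_kernel hs_approx_kernel Kk in2 in0 r0).
by rewrite normsq_kernel_diff.
Qed.

Lemma hs_norm_residual (r : R) : 0 <= r ->
  residual_sq A B c alpha beta p <= r ^+ 2 ->
  (hs_norm (op_sub (Kop A B c) (kernel_op leb approx_kernel)) <= r%:E)%E.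
Proof.
move=> r0 pr.
have Kk f : L2 f -> op_sub (Kop A B c) (kernel_op leb approx_kernel) f =
    kernel_op leb (fun z => fourier_kernel z - approx_kernel z) f.
  move=> /L2P f2; apply/funext => y.
  by rewrite (kernel_opB (y : lebR R) hs_fourier_kernel hs_approx_kernel f2) /op_sub Kop_kernel.
apply: (kernel_op_hs_norm (hs_kernelB hs_fourier_kernel hs_approx_kernel) Kk r0).
by rewrite normsq_kernel_diff.
Qed.

End FourierKernel.

(** * Moments and essential diameter *)

Section Moments.
Context (R : realType).
Local Notation C := R[i].
Local Notation leb := (@completed_lebesgue_measure R).

Lemma Rintegral_scale (c : R) (E : set R) (f : R -> R) : 0 < c ->
  lebesgue_measurable E -> measurable_fun [set: lebR R] (f : lebR R -> R) ->
  leb.-integrable (E : set (lebR R)) (fun x : lebR R => (f (c * x))%:E) ->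
  \int[leb]_(x in (scale_set c E : set (lebR R))) f x =
  c * \int[leb]_(x in (E : set (lebR R))) f (c * x).
Proof.
move=> c0 mE mf fi.
have mf' : measurable_fun [set: lebR R] (fun x : lebR R => (f x)%:E).
  exact/measurable_EFinP.
rewrite /Rintegral [in LHS]integralE [in RHS]integralE.
have Epos : (\int[leb]_(x in (scale_set c E : set (lebR R))) (fun x => (f x)%:E)^\+ x =
  c%:E * \int[leb]_(x in (E : set (lebR R))) (fun x => (f (c * x)%R)%:E)^\+ x)%E.
  rewrite ge0_integral_scale//; last exact: measurable_funepos.
  by congr (_ * _)%E; apply: eq_integral => x _; rewrite !funeposE.
have Eneg : (\int[leb]_(x in (scale_set c E : set (lebR R))) (fun x => (f x)%:E)^\- x =
  c%:E * \int[leb]_(x in (E : set (lebR R))) (fun x => (f (c * x)%R)%:E)^\- x)%E.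
  rewrite ge0_integral_scale//; last exact: measurable_funeneg.
  by congr (_ * _)%E; apply: eq_integral => x _; rewrite !funenegE.
rewrite Epos Eneg -muleBr// ?fineM//.
- rewrite fin_numB; apply/andP; split; first exact: integrable_pos_fin_num.
  exact: integrable_neg_fin_num.
- by apply: fin_num_adde_defr; exact: integrable_pos_fin_num.
Qed.

Lemma measurable_shiftX (a : R) (n : nat) :
  measurable_fun [set: lebR R] (fun x : lebR R => ((x : R) - a) ^+ n).
Proof.
apply: measurable_funX; apply: measurable_funB; last exact: measurable_cst.
exact: measurable_id_leb.
Qed.

Section FixedSet.
Variable E : set R.
Hypotheses (mE : lebesgue_measurable E) (bE : bounded_set E).
Hypothesis finE : (leb (E : set (lebR R)) < +oo)%E.

Lemma shiftX_bounded (a : R) (n : nat) :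
  exists M, forall x, E x -> `|(x - a) ^+ n| <= M.
Proof.
have [M M0 EM] := bounded_setP bE; exists ((M + `|a|) ^+ n) => x Ex.
rewrite normrX lerXn2r ?nnegrE ?addr_ge0//.
by rewrite (le_trans (ler_normB _ _))// lerD2r EM.
Qed.

(** The factor k serves [gram_entryE], with k = 1 on A and k = 2 pi on cB. *)
Lemma integrable_indic_shiftX (a k : R) (n : nat) :
  leb.-integrable [set: lebR R] (fun x : lebR R => (\1_E x * (k * (x - a)) ^+ n)%:E).
Proof.
have [M EM] := shiftX_bounded a n.
have mX : measurable_fun [set: lebR R] (fun x : lebR R => (k * ((x : R) - a)) ^+ n).
  under eq_fun do rewrite exprMn.
  exact: measurable_funM (measurable_cst _) (measurable_shiftX a n).
apply: (@integrable_indic_bounded _ (lebR R) _ leb E _ (`|k ^+ n| * M) mE finE mX) => x Ex.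
by rewrite exprMn normrM ler_wpM2l// EM.
Qed.

Lemma integrable_shiftX (a : R) (n : nat) :
  leb.-integrable (E : set (lebR R)) (fun x : lebR R => (((x : R) - a) ^+ n)%:E).
Proof.
have [M EM] := shiftX_bounded a n.
apply: (@measurable_bounded_integrable _ (lebR R) R leb
  (fun x : lebR R => ((x : R) - a) ^+ n) E mE finE
  (measurable_funTS (measurable_shiftX a n))).
exists M; split; first exact: num_real.
by move=> K MK x /= Ex; rewrite (le_trans (EM _ Ex))// ltW.
Qed.

End FixedSet.

Variables (A B : set R) (c alpha beta : R).
Hypotheses (mA : lebesgue_measurable A) (mB : lebesgue_measurable B).
Hypotheses (bA : bounded_set A) (bB : bounded_set B).
Hypotheses (finA : (leb (A : set (lebR R)) < +oo)%E).
Hypotheses (finB : (leb (B : set (lebR R)) < +oo)%E).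
Hypothesis c_gt0 : 0 < c.

Let cB := scale_set c B.
Let D : set (lebR R * lebR R) := A `*` cB.
Let t := @tmap R c alpha beta.

(** On the rectangle t^n is a product of a function of x and one of xi, so Fubini applies; then xi =
    c eta gives the Jacobian c and turns 2 pi into 2 pi c. *)
Lemma gram_entryE (j k : nat) : gram_entry A B c alpha beta j k =
  c * (2 * pi * c) ^+ (j + k) *
  (\int[leb]_(x in (A : set (lebR R))) ((x : R) - alpha) ^+ (j + k)) *
  (\int[leb]_(y in (B : set (lebR R))) ((y : R) - beta) ^+ (j + k)).
Proof.
have bcB : bounded_set cB by exact: bounded_scale_set.
have mcB : lebesgue_measurable cB by exact: measurable_scale_set.
have fcB : (leb (cB : set (lebR R)) < +oo)%E by exact: leb_scale_fin.
rewrite /gram_entry; set n := (j + k)%N.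
rewrite (integral_nu alpha beta mA mB c_gt0 (f := fun s => s ^+ n)); last first.
  exact: exprn_measurable.
pose u (x : lebR R) := \1_A x * (1 * ((x : R) - alpha)) ^+ n.
pose v (y : lebR R) := \1_cB y * (2 * pi * ((y : R) - c * beta)) ^+ n.
have iu : leb.-integrable [set: lebR R] (EFin \o u) by exact: integrable_indic_shiftX.
have iv : leb.-integrable [set: lebR R] (EFin \o v) by exact: integrable_indic_shiftX.
have uvE z : \1_D z * t z ^+ n = u z.1 * v z.2.
  case: z => x y; rewrite /u /v indic_setX /t /tmap/= mul1r.
  rewrite [2 * pi * (x - alpha) * _]mulrAC exprMn; ring.
have iuv : (leb \x leb)%E.-integrable setT (fun z => (u z.1 * v z.2)%:E).
  under eq_fun do rewrite -uvE.
  have [M M0 tM] := tmap_bounded alpha beta bA bB c_gt0.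
  apply: (integrable_indic_bounded (M := M ^+ n)).
  - exact: measurable_scaled_rect.
  - exact: leb2_scaled_rect.
  - by apply: measurable_funX; exact: measurable_tmap.
  - by move=> z Dz; rewrite normrX lerXn2r ?nnegrE// tM.
have -> : (\int[leb \x leb]_z (\1_D z * t z ^+ n)%:E =
    \int[leb \x leb]_z (u z.1 * v z.2)%:E)%E.
  by apply: eq_integral => z _; rewrite uvE.
rewrite (Rintegral_prod iu iv iuv).
have -> : \int[leb]_x u x = \int[leb]_(x in (A : set (lebR R))) (x - alpha) ^+ n.
  rewrite /Rintegral (integral_indic_restrict leb A); congr fine.
  by apply: eq_integral => x _; rewrite /u mul1r.
have -> : \int[leb]_y v y =
    \int[leb]_(y in (cB : set (lebR R))) (2 * pi * (y - c * beta)) ^+ n.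
  by rewrite /Rintegral (integral_indic_restrict leb cB).
have EB (y : lebR R) : (2 * pi * (c * (y : R) - c * beta)) ^+ n =
    (2 * pi * c) ^+ n * ((y : R) - beta) ^+ n.
  by rewrite -mulrBr mulrA exprMn.
have iB := integrable_shiftX mB bB finB beta n.
have mv : measurable_fun [set: lebR R] (fun y : lebR R => (2 * pi * ((y : R) - c * beta)) ^+ n).
  under eq_fun do rewrite exprMn.
  exact: measurable_funM (measurable_cst _) (measurable_shiftX _ n).
have iv' : leb.-integrable (B : set (lebR R))
    (fun y : lebR R => ((2 * pi * (c * (y : R) - c * beta)) ^+ n)%:E).
  under eq_fun do rewrite EB EFinM.
  exact: integrableZl iB.
rewrite (Rintegral_scale c_gt0 mB mv iv').
have -> : \int[leb]_(y in (B : set (lebR R))) (2 * pi * (c * y - c * beta)) ^+ n =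
    (2 * pi * c) ^+ n * \int[leb]_(y in (B : set (lebR R))) (y - beta) ^+ n.
  rewrite -(RintegralZl _ mB iB); congr fine; apply: eq_integral => y _.
  by rewrite EB.
by ring.
Qed.

Lemma residual_sq_le_moment (N : nat) (p : {poly C}) : (size p <= N)%N ->
  (forall s : R, cabs (expi (- s) - p.[s%:C]) <= `|s| ^+ N / N`!%:R) ->
  residual_sq A B c alpha beta p <= (N`!%:R^-1) ^+ 2 * gram_entry A B c alpha beta N N.
Proof.
move=> pN pb.
(* The moment of order 2N is the Gram entry just outside the N by N matrix, so t^N is taken as the
   last of N + 1 monomials. *)
have m2 := @cL2_nu_mon R A B c alpha beta mA mB bA bB finA finB c_gt0 N.+1 ord_max.
set nuM := nu_measure alpha beta mA mB c_gt0 in m2.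
have g2 := cL2Z (N`!%:R^-1)%:C m2.
have cabs_real (x : R) : cabs x%:C ^+ 2 = x ^+ 2.
  by rewrite cabs_sqE [complex.Re _]/= [complex.Im _]/= expr0n addr0.
have gE (s : R) : cabs ((N`!%:R^-1)%:C * (s ^+ N)%:C) ^+ 2 =
    (N`!%:R^-1) ^+ 2 * s ^+ (N + N).
  by rewrite cabsM exprMn !cabs_real exprD expr2.
have le2 (s : R) : cabs (expi (- s) - p.[s%:C]) ^+ 2 <=
    cabs ((N`!%:R^-1)%:C * (s ^+ N)%:C) ^+ 2.
  rewrite -rmorphM cabs_real.
  rewrite -[leRHS]real_normK ?num_real// lerXn2r ?nnegrE ?cabs_ge0//.
  have Ni : 0 <= N`!%:R^-1 :> R by rewrite invr_ge0 ler0n.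
  by rewrite (le_trans (pb s))// normrM normrX (ger0_norm Ni) mulrC.
have ep2 : cL2 nuM (fun s : R => expi (- s) - p.[s%:C]).
  apply: (cL2B (cL2_nu_expi alpha beta mA mB bA bB finA finB c_gt0)).
  exact: (@cL2_nu_poly R A B c alpha beta mA mB bA bB finA finB c_gt0).
rewrite /residual_sq /gram_entry (nuE alpha beta mA mB c_gt0) -/nuM.
have i2 : nuM.-integrable setT (fun s : R => (s ^+ (N + N))%:E).
  have := cL2_integrable m2; congr (_.-integrable _ _); apply/funext => s.
  by rewrite cabs_real -exprM muln2 addnn.
have -> : N`!%:R^-1 ^+ 2 * fine (\int[nuM]_s (s ^+ (N + N))%:E) =
    normsq nuM (fun s : R => (N`!%:R^-1)%:C * (s ^+ N)%:C).
  rewrite /normsq -[LHS](RintegralZl _ measurableT i2); congr fine.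
  by apply: eq_integral => s _; rewrite gE.
suff H : normsq nuM (fun s : R => expi (- s) - p.[s%:C]) <=
    normsq nuM (fun s : R => (N`!%:R^-1)%:C * (s ^+ N)%:C) by exact: H.
rewrite -lee_fin (normsqE g2) (normsqE ep2).
apply: ge0_le_integral.
- exact: measurableT.
- by move=> s _; rewrite lee_fin sqr_ge0.
- by apply/measurable_EFinP; exact: cmeasurable_cabs ep2.1.
- by apply/measurable_EFinP; exact: cmeasurable_cabs g2.1.
- by move=> s _; rewrite lee_fin le2.
Qed.

End Moments.

(** * Essential diameter and essential hull *)

Section EssentialDiameter.
Context (R : realType).
Local Notation leb := (@completed_lebesgue_measure R).
Variable E : set R.
Hypotheses (mE : lebesgue_measurable E) (bE : bounded_set E).

Lemma lebesgue_measurable_itv (i : interval R) : lebesgue_measurable [set` i].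
Proof. by apply: sub_caratheodory; exact: measurable_itv. Qed.

Lemma lebesgue_measurableI (X Y : set R) :
  lebesgue_measurable X -> lebesgue_measurable Y -> lebesgue_measurable (X `&` Y).
Proof. by move=> mX mY; exact: (@measurableI _ (lebR R) X Y mX mY). Qed.

Let dist (z : lebR R * lebR R) : \bar R :=
  if z \in ((E : set (lebR R)) `*` (E : set (lebR R)))
  then (`|(z.1 : R) - (z.2 : R)|)%:E else -oo%E.

Let ess_dist := ess_sup (leb \x leb)%E dist.

Let ess_dist_le (d : R) : (forall x y, E x -> E y -> `|x - y| <= d) ->
  (ess_dist <= d%:E)%E.
Proof.
move=> Ed; apply/ess_supP; apply: aeW => -[x y]; rewrite /dist.
by case: ifPn => [/set_mem[Ex Ey]|_]; rewrite ?leNye// lee_fin Ed.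
Qed.

(** Otherwise all of X x Y would lie in the null set where the distance exceeds its essential
    supremum, although its product measure is positive. *)
Let ess_dist_ge (X Y : set R) : lebesgue_measurable X -> lebesgue_measurable Y ->
  X `<=` E -> Y `<=` E -> (0 < leb X)%E -> (0 < leb Y)%E ->
  exists x y, [/\ X x, Y y & (`|x - y|%:E <= ess_dist)%E].
Proof.
move=> mX mY XE YE X0 Y0; apply: contrapT => noxy.
have [N [mN N0 subN]] := ess_sup_ge (leb \x leb)%E dist.
have XYN : X `*` Y `<=` N.
  move=> [x y] [/= Xx Yy]; apply: subN => /= xy; apply: noxy; exists x, y; split=> //.
  by move: xy; rewrite /dist mem_set//; split; [exact: XE | exact: YE].
have : ((leb \x leb)%E (X `*` Y) <= 0)%E.
  rewrite -N0; apply: le_measure; rewrite ?inE//.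
  exact: (@measurableX _ _ (lebR R) (lebR R)).
rewrite /= (product_measure1E leb leb mX mY) leNgt => /negP; apply.
exact: mule_gt0.
Qed.

Lemma ess_diam_le (d : R) : 0 <= d -> (forall x y, E x -> E y -> `|x - y| <= d) ->
  ess_diam E <= d.
Proof.
move=> d0 Ed; rewrite /ess_diam; case: ifPn => // E0.
have := ess_dist_le Ed; rewrite -/dist -/ess_dist.
by case: ess_dist => [r| |] //=; rewrite lee_fin.
Qed.

Lemma ess_diam_ge (X Y : set R) (d : R) :
  lebesgue_measurable X -> lebesgue_measurable Y ->
  X `<=` E -> Y `<=` E -> (0 < leb X)%E -> (0 < leb Y)%E ->
  (forall x y, X x -> Y y -> d <= `|x - y|) -> d <= ess_diam E.
Proof.
move=> mX mY XE YE X0 Y0 dXY.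
have E0 : leb (E : set (lebR R)) != 0%E.
  rewrite gt_eqF// (lt_le_trans X0)//.
  by apply: (@le_measure _ _ (lebR R) leb); rewrite ?inE.
rewrite /ess_diam (negbTE E0) -/dist -/ess_dist.
have [x [y [Xx Yy]]] := ess_dist_ge mX mY XE YE X0 Y0.
have [M M0 EM] := bounded_setP bE.
(* The essential supremum has to be finite, since [fine] would send +oo to 0. *)
have : (ess_dist <= (M + M)%:E)%E.
  apply: ess_dist_le => u v Eu Ev.
  by rewrite (le_trans (ler_normB _ _))// lerD// EM.
case: ess_dist => [r| |] //= _; rewrite lee_fin; exact: le_trans (dXY _ _ Xx Yy).
Qed.

Hypothesis E_gt0 : (0 < leb (E : set (lebR R)))%E.

Let up (u : R) := E `&` `]u, +oo[%classic.
Let dn (v : R) := E `&` `]-oo, v[%classic.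
Let mup u : lebesgue_measurable (up u).
Proof. by apply: lebesgue_measurableI => //; exact: lebesgue_measurable_itv. Qed.
Let mdn v : lebesgue_measurable (dn v).
Proof. by apply: lebesgue_measurableI => //; exact: lebesgue_measurable_itv. Qed.

(* sup U and inf V are the essential supremum and infimum of E. *)
Let U := [set u | (0 < leb (up u))%E].
Let V := [set v | (0 < leb (dn v))%E].

Let has_supU : has_sup U.
Proof.
have [M M0 EM] := bounded_setP bE; split.
  exists (- M - 1); rewrite /U/= /up setIidl// => x Ex /=.
  by rewrite in_itv/= andbT; have := EM _ Ex; rewrite ler_norml => /andP[]; lra.
exists M => u /=; apply: contraTT; rewrite -ltNge -leNgt => Mu.
rewrite (_ : up u = set0) ?measure0// -subset0 => x [Ex] /=.
rewrite in_itv/= andbT => ux.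
by have := EM _ Ex; rewrite ler_norml => /andP[_]; lra.
Qed.

Let has_infV : has_inf V.
Proof.
have [M M0 EM] := bounded_setP bE; split.
  exists (M + 1); rewrite /V/= /dn setIidl// => x Ex /=.
  by rewrite in_itv/=; have := EM _ Ex; rewrite ler_norml => /andP[]; lra.
exists (- M) => u /=; apply: contraTT; rewrite -ltNge -leNgt => Mu.
rewrite (_ : dn u = set0) ?measure0// -subset0 => x [Ex] /=.
rewrite in_itv/= => ux.
by have := EM _ Ex; rewrite ler_norml => /andP[+ _]; lra.
Qed.

(** For u in U and v in V, the parts of E above u and below v have positive measure and are at
    distance at least u - v. *)
Let sub_le_ess_diam : sup U - inf V <= ess_diam E.
Proof.
apply/ler_addgt0Pr => e e0; have e2 : 0 < e / 2 by rewrite divr_gt0.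
have [u Uu u_lt] := sup_adherent e2 has_supU.
have [v Vv v_lt] := inf_adherent e2 has_infV.
have : u - v <= ess_diam E.
  apply: (ess_diam_ge (mup u) (mdn v) _ _ Uu Vv); [exact: subIsetl|exact: subIsetl|].
  move=> x y [_ /=]; rewrite in_itv/= andbT => ux [_ /=]; rewrite in_itv/= => yv.
  by rewrite (le_trans _ (ler_norm _))//; lra.
by move: u_lt v_lt; set s := sup _; set i := inf _; lra.
Qed.

(** Each sup U + 1/(n+1) lies outside U, so the part of E beyond it is null; a countable union over
    n follows. *)
Let ae_le_sup : {ae leb, forall x : lebR R, E x -> (x : R) <= sup U}.
Proof.
have : forall n : nat, {ae leb, forall x : lebR R, E x -> (x : R) <= sup U + n.+1%:R^-1}.
  move=> n; exists (up (sup U + n.+1%:R^-1)); split; first exact: mup.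
    apply/eqP; rewrite eq_le measure_ge0 andbT leNgt; apply/negP => Un.
    have := ub_le_sup has_supU.2 Un.
    by rewrite leNgt ltrDl invr_gt0 ltr0n.
  move=> x /= /not_implyP[Ex /negP]; rewrite -ltNge => xs.
  by split=> //=; rewrite in_itv/= andbT.
move/ae_foralln; apply: filterS => x xn Ex; apply/ler_addgt0Pr => e e0.
have [n ne] : exists n : nat, n.+1%:R^-1 < e.
  exists (Num.truncn e^-1); rewrite -[ltRHS]invrK ltf_pV2 ?posrE ?invr_gt0//.
  exact: truncnS_gt.
by rewrite (le_trans (xn n Ex))// lerD2l ltW.
Qed.

Let ae_ge_inf : {ae leb, forall x : lebR R, E x -> inf V <= (x : R)}.
Proof.
have : forall n : nat, {ae leb, forall x : lebR R, E x -> inf V - n.+1%:R^-1 <= (x : R)}.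
  move=> n; exists (dn (inf V - n.+1%:R^-1)); split; first exact: mdn.
    apply/eqP; rewrite eq_le measure_ge0 andbT leNgt; apply/negP => Vn.
    have := ge_inf has_infV.2 Vn.
    by rewrite leNgt gtrDl oppr_lt0 invr_gt0 ltr0n.
  move=> x /= /not_implyP[Ex /negP]; rewrite -ltNge => xs.
  by split=> //=; rewrite in_itv/=.
move/ae_foralln; apply: filterS => x xn Ex; apply/ler_addgt0Pr => e e0.
have [n ne] : exists n : nat, n.+1%:R^-1 < e.
  exists (Num.truncn e^-1); rewrite -[ltRHS]invrK ltf_pV2 ?posrE ?invr_gt0//.
  exact: truncnS_gt.
by rewrite -lerBlDr (le_trans _ (xn n Ex))// lerD2l lerN2 ltW.
Qed.

Lemma ess_diam_center : exists a : R,
  {ae leb, forall x : lebR R, E x -> `|(x : R) - a| <= ess_diam E / 2}.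
Proof.
exists ((sup U + inf V) / 2); apply: filterS2 ae_le_sup ae_ge_inf => x xU xV Ex.
have := sub_le_ess_diam; move: (xU Ex) (xV Ex).
by rewrite ler_norml; set s := sup _; set i := inf _; set D := ess_diam E; lra.
Qed.

End EssentialDiameter.

(** * Moments minimised over the centre *)

Section MomentInf.
Context (R : realType).
Local Notation leb := (@completed_lebesgue_measure R).
Variable E : set R.
Hypotheses (mE : lebesgue_measurable E) (bE : bounded_set E).
Hypothesis finE : (leb (E : set (lebR R)) < +oo)%E.

Let moment (n : nat) (a : R) := \int[leb]_(x in (E : set (lebR R))) ((x : R) - a) ^+ n.

Lemma normr_even_exp (x : R) N : `|x| ^+ (2 * N) = x ^+ (2 * N).
Proof. by rewrite !exprM real_normK// num_real. Qed.

(** By the binomial formula the moment is a polynomial in its centre, hence continuous, as the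
    extreme value theorem requires. The raw moments are written with [- 0] to match
    [integrable_shiftX]. *)
Lemma moment_horner (n : nat) : exists q : {poly R}, forall a, moment n a = q.[a].
Proof.
pose mm i := \int[leb]_(x in (E : set (lebR R))) ((x : R) - 0) ^+ i.
exists (\sum_(i < n.+1) ((-1) ^+ i * mm (n - i)%N *+ 'C(n, i))%:P * 'X^i) => a.
rewrite horner_sum /moment /Rintegral.
pose f (i : 'I_n.+1) (x : lebR R) : \bar R :=
  (((-1) ^+ i * a ^+ i *+ 'C(n, i))%:E * (((x : R) - 0) ^+ (n - i))%:E)%E.
have fi i : leb.-integrable (E : set (lebR R)) (f i).
  exact: integrableZl (integrable_shiftX mE bE finE 0 _).
rewrite (eq_integral (fun x => (\sum_(i < n.+1) f i x)%E)); last first.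
  move=> x _; rewrite /f sumEFin exprBn; congr EFin; apply: eq_bigr => i _.
  by rewrite subr0 -!mulrnAl; ring.
rewrite (integral_sum mE fi).
rewrite -sum_fine; last by move=> i _; exact: integrable_fin_num.
apply: eq_bigr => i _; rewrite !hornerE/=.
rewrite (integralZl mE (integrable_shiftX mE bE finE 0 _)) fineM//.
  by rewrite -[fine (integral _ _ _)]/(mm (n - i)%N)/= -!mulrnAl; ring.
by apply: integrable_fin_num => //; exact: integrable_shiftX.
Qed.

Lemma moment_ge0 N a : 0 <= moment (2 * N) a.
Proof.
by apply: Rintegral_ge0 => x _; rewrite -normr_even_exp exprn_ge0.
Qed.

Lemma moment_infE N : moment_inf E N = inf [set moment (2 * N) a | a in [set: R]].
Proof.
rewrite /moment_inf; congr inf; apply/seteqP; split=> _ [a _ <-]; exists a => //;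
  by apply: eq_Rintegral => x _; rewrite normr_even_exp.
Qed.

Lemma moment_inf_le N a : moment_inf E N <= moment (2 * N) a.
Proof.
rewrite moment_infE; apply: ge_inf; last by exists a.
by exists 0 => _ [b _ <-]; exact: moment_ge0.
Qed.

Lemma moment_inf_ge N (r : R) : (forall a, r <= moment (2 * N) a) -> r <= moment_inf E N.
Proof.
move=> rE; rewrite moment_infE; apply: lb_le_inf; first by exists (moment (2 * N) 0), 0.
by move=> _ [b _ <-].
Qed.

Lemma moment_inf_ge0 N : 0 <= moment_inf E N.
Proof. by apply: moment_inf_ge => a; exact: moment_ge0. Qed.

(* Projecting the centre on an interval that contains E does not increase the moment. *)
Lemma moment_inf_attained N : exists a, moment_inf E N = moment (2 * N) a.
Proof.
have [M M0 EM] := bounded_setP bE.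
have [q qE] := moment_horner (2 * N).
have MM : - M <= M by lra.
have [a aM amin] := @EVT_min R (horner q) _ _ MM
  (continuous_subspaceT (@continuous_horner R q)).
exists a; apply/eqP; rewrite eq_le moment_inf_le/=; apply: moment_inf_ge => b.
pose b' := Num.max (- M) (Num.min M b).
have b'M : b' \in `[- M, M].
  by rewrite in_itv/= le_max lexx/= ge_max MM ge_min lexx.
rewrite qE (le_trans (amin _ b'M))// -qE.
apply: le_Rintegral => //; [exact: integrable_shiftX|exact: integrable_shiftX|].
move=> x Ex; rewrite -(normr_even_exp (_ - b')) -(normr_even_exp (_ - b)).
rewrite lerXn2r ?nnegrE//.
have := EM _ Ex; rewrite ler_norml => /andP[xM Mx].
rewrite /b' minC; have [bM|Mb] := leP b M.
  have [Mb|bM'] := leP (- M) b; first by [].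
  rewrite ger0_norm; last by lra.
  by rewrite ger0_norm; lra.
rewrite (max_idPr MM) ler0_norm; last by lra.
by rewrite ler0_norm; lra.
Qed.

Lemma moment_inf_le_diam N :
  moment_inf E N <= fine (leb (E : set (lebR R))) * (ess_diam E / 2) ^+ (2 * N).
Proof.
(* A null set has no essential hull to be centred; there the bound reads 0 <= 0. *)
have [E0|E0] := eqVneq (leb (E : set (lebR R))) 0%E.
  rewrite E0 mul0r (le_trans (moment_inf_le N 0))// /moment /Rintegral.
  rewrite (null_set_integral mE _ E0)//.
  by apply/measurable_EFinP; exact: measurable_funTS (measurable_shiftX _ _).
have E_gt0 : (0 < leb (E : set (lebR R)))%E by rewrite lt_neqAle eq_sym E0 measure_ge0.
have [a aE] := ess_diam_center mE bE E_gt0.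
apply: le_trans (moment_inf_le N a) _.
rewrite mulrC -(Rintegral_cst leb mE) /moment.
have i1 := integrable_shiftX mE bE finE a (2 * N).
have mX := measurable_shiftX a (2 * N).
have even_ge0 (y : R) : (0 <= (y ^+ (2 * N))%:E)%E.
  by rewrite lee_fin -normr_even_exp exprn_ge0.
apply: fine_le.
- by apply: integrable_fin_num; [exact: mE | exact: i1].
- by rewrite (integral_cst leb mE) fin_numM// ge0_fin_numE.
apply: (ae_ge0_le_integral mE).
- by move=> x _; exact: even_ge0.
- by apply/measurable_EFinP; exact: measurable_funTS mX.
- by move=> x _; exact: even_ge0.
- exact: measurable_cst.
- apply: filterS aE => x xD Ex; rewrite lee_fin -normr_even_exp.
  rewrite lerXn2r ?nnegrE ?xD//.
  exact: le_trans (normr_ge0 _) (xD Ex).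
Qed.

End MomentInf.

(** * Exact moments of intervals *)

Section IntervalMoments.
Context (R : realType).
Local Notation leb := (@completed_lebesgue_measure R).

Lemma integral_itv_evenX (a b u : R) N : a < b ->
  (\int[leb]_(x in (`[a, b]%classic : set (lebR R))) (((x : R) - u) ^+ (2 * N))%:E =
   (((b - u) ^+ (2 * N).+1 - (a - u) ^+ (2 * N).+1) / (2 * N).+1%:R)%:E)%E.
Proof.
move=> ab.
have mX : measurable_fun [set: measurableTypeR R] (fun x : R => (x - u) ^+ (2 * N)).
  by apply: measurable_funX; exact: measurable_funB.
have X0 (x : R) : (0 <= ((x - u) ^+ (2 * N))%:E)%E.
  by rewrite lee_fin -normr_even_exp exprn_ge0.
rewrite (@ge0_integral_leb R `[a, b]%classic (fun x : R => ((x - u) ^+ (2 * N))%:E))//;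
  last exact/measurable_EFinP/measurable_funTS.
pose P : {poly R} := ((2 * N).+1%:R^-1)%:P * ('X - u%:P) ^+ (2 * N).+1.
have PE x : P.[x] = (2 * N).+1%:R^-1 * (x - u) ^+ (2 * N).+1 by rewrite /P !hornerE.
have dP x : P^`().[x] = (x - u) ^+ (2 * N).
  rewrite /P derivM derivC mul0r add0r deriv_exp derivXsubC mul1r.
  by rewrite hornerM hornerC hornerMn horner_exp hornerXsubC/= -(mulr_natl (_ ^+ _)) mulKf// pnatr_eq0.
have -> : (\int[lebesgue_measure]_(x in `[a, b]) ((x - u) ^+ (2 * N))%:E)%E =
    ((P.[b])%:E - (P.[a])%:E)%E.
  apply: continuous_FTC2 => //.
  - apply: continuous_subspaceT.
    rewrite (_ : (fun x => _) = horner (('X - u%:P) ^+ (2 * N))).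
      exact: continuous_horner.
    by apply/funext => x; rewrite !hornerE.
  - split; first by move=> x _; exact: derivable_horner.
    + by apply: cvg_at_right_filter; exact: continuous_horner.
    + by apply: cvg_at_left_filter; exact: continuous_horner.
  - by move=> x _; rewrite -derivE dP.
by rewrite -EFinB !PE; congr EFin; ring.
Qed.

(** In the sum of the two binomial expansions odd powers of d cancel, even powers contribute
    nonnegatively, and d^0 gives 2 h^(2N+1). *)
Lemma odd_power_midpoint (h d : R) N : 0 <= h ->
  2 * h ^+ (2 * N).+1 <= (h + d) ^+ (2 * N).+1 + (h - d) ^+ (2 * N).+1.
Proof.
move=> h0; rewrite exprDn exprBn -big_split/= big_ord_recl/=.
rewrite -[leLHS]addr0; apply: lerD.
  by rewrite !expr0 subn0 bin0 !mulr1n mul1r !mulr1 mulr_natl mulr2n.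
apply: sumr_ge0 => i _; rewrite -signr_odd.
case: (boolP (odd (bump 0 i))) => ib; rewrite ?expr1 ?expr0.
  by rewrite mulN1r mulNr mulNrn subrr.
rewrite mul1r; suff hd : 0 <= h ^+ ((2 * N).+1 - bump 0 i) * d ^+ bump 0 i.
  by rewrite addr_ge0// mulrn_wge0.
by apply: mulr_ge0; [exact: exprn_ge0 | exact: exprn_even_ge0].
Qed.

Lemma leb_itvoo (x y : R) : x < y -> leb `]x, y[%classic = (y - x)%:E.
Proof.
move=> xy; apply: etrans (lebesgue_measure_itv `]x, y[) _.
by rewrite /= lte_fin xy EFinB.
Qed.

Lemma leb_itvcc (x y : R) : leb `[x, y]%classic = (Num.max 0 (y - x))%:E.
Proof.
apply: etrans (lebesgue_measure_itv `[x, y]) _.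
rewrite /= lte_fin; case: ltP => xy.
  by rewrite -EFinB max_r// subr_ge0 ltW.
by rewrite max_l// subr_le0.
Qed.

Variable E : set R.
Hypotheses (iE : is_interval E) (bE : bounded_set E).
Hypotheses (mE : lebesgue_measurable E) (E_gt0 : (0 < leb (E : set (lebR R)))%E).

Let a := inf E.
Let b := sup E.

Let E_neq0 : E !=set0.
Proof.
apply/set0P; apply/eqP => E0; move: E_gt0; rewrite E0 measure0.
by rewrite ltxx.
Qed.

Let has_supE : has_sup E.
Proof.
have [M M0 EM] := bounded_setP bE; split=> //; exists M => x Ex.
exact: le_trans (ler_norm _) (EM _ Ex).
Qed.

Let has_infE : has_inf E.
Proof.
have [M M0 EM] := bounded_setP bE; split=> //; exists (- M) => x Ex.
by have := EM _ Ex; rewrite ler_norml => /andP[].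
Qed.

Let E_cc : E `<=` `[a, b]%classic.
Proof.
move=> x Ex; rewrite /= in_itv/=; apply/andP; split.
  by have := ge_inf has_infE.2 Ex.
by have := ub_le_sup has_supE.2 Ex.
Qed.

Let E_oo : `]a, b[%classic `<=` E.
Proof.
move=> z /=; rewrite in_itv/= => /andP[az zb].
have az0 : 0 < z - a by rewrite subr_gt0.
have zb0 : 0 < b - z by rewrite subr_gt0.
have [x Ex xz] := inf_adherent az0 has_infE.
have [y Ey yz] := sup_adherent zb0 has_supE.
apply: (iE Ex Ey); apply/andP; split.
  by move: xz; rewrite -/a; lra.
by move: yz; rewrite -/b; lra.
Qed.

Let leb_le (X Y : set R) : lebesgue_measurable X -> lebesgue_measurable Y ->
  X `<=` Y -> (leb X <= leb Y)%E.
Proof. by move=> mX mY XY; apply: (@le_measure _ _ (lebR R) leb); rewrite ?inE. Qed.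

Let ab : a < b.
Proof.
rewrite ltNge; apply/negP => ba; move: E_gt0; rewrite ltNge => /negP; apply.
apply: le_trans (leb_le mE (lebesgue_measurable_itv _) E_cc) _.
by rewrite leb_itvcc max_l// subr_le0.
Qed.

Let leb_E : leb (E : set (lebR R)) = (b - a)%:E.
Proof.
apply/eqP; rewrite eq_le; apply/andP; split.
  apply: le_trans (leb_le mE (lebesgue_measurable_itv _) E_cc) _.
  by rewrite leb_itvcc max_r// subr_ge0 ltW.
rewrite -(leb_itvoo ab); exact: leb_le (lebesgue_measurable_itv _) mE E_oo.
Qed.

Let ess_diam_E : ess_diam E = b - a.
Proof.
apply/eqP; rewrite eq_le; apply/andP; split.
  apply: ess_diam_le => //; first by rewrite subr_ge0 ltW.
  move=> x y /E_cc/= + /E_cc/=; rewrite !in_itv/= => /andP[ax xb] /andP[ay yb].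
  by rewrite ler_norml; lra.
apply/ler_addgt0Pr => e e0; rewrite -lerBlDr.
(* Two end pieces of length at most e / 2, at mutual distance at least b - a - e; [max] and [min]
   keep them inside ]a, b[ when e is large. *)
pose x := Num.max a (b - e / 2); pose y := Num.min b (a + e / 2).
have e2 : 0 < e / 2 by rewrite divr_gt0.
have xb : x < b by rewrite gt_max ab/= gtrDl oppr_lt0.
have ay : a < y by rewrite lt_min ab/= ltrDl.
apply: (ess_diam_ge (X := `]x, b[%classic) (Y := `]a, y[%classic) _ bE).
- exact: mE.
- exact: lebesgue_measurable_itv.
- exact: lebesgue_measurable_itv.
- apply: subset_trans E_oo => z /=; rewrite !in_itv/= => /andP[+ ->].
  by rewrite gt_max => /andP[->].
- apply: subset_trans E_oo => z /=; rewrite !in_itv/= => /andP[->].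
  by rewrite lt_min => /andP[->].
- by rewrite (leb_itvoo xb) lte_fin subr_gt0.
- by rewrite (leb_itvoo ay) lte_fin subr_gt0.
- move=> u v /=; rewrite !in_itv/= gt_max lt_min => /andP[/andP[_ bu] _] /andP[_ /andP[_ va]].
  by rewrite (le_trans _ (ler_norm _))//; lra.
Qed.

(** Whichever endpoints belong to E, its integral is caught between those over ]a, b[ and [a, b],
    which agree. *)
Let integral_E (f : R -> \bar R) : measurable_fun [set: measurableTypeR R] f ->
  (forall x, 0 <= f x)%E ->
  (\int[leb]_(x in (E : set (lebR R))) f x =
   \int[leb]_(x in (`[a, b]%classic : set (lebR R))) f x)%E.
Proof.
move=> mf f0; have mf' := measurable_fun_leb mf.
apply/eqP; rewrite eq_le; apply/andP; split.
  apply: (ge0_subset_integral leb mE (lebesgue_measurable_itv _) _ _ E_cc).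
    exact: measurable_funTS.
  by move=> x _; exact: f0.
rewrite (@ge0_integral_leb R `[a, b]%classic f)//; last exact: measurable_funTS.
rewrite (@integral_itv_bndoo _ a b f true false); last exact: measurable_funTS.
rewrite -(@ge0_integral_leb R `]a, b[%classic f)//; last exact: measurable_funTS.
apply: (ge0_subset_integral leb (lebesgue_measurable_itv _) mE _ _ E_oo).
  exact: measurable_funTS.
by move=> x _; exact: f0.
Qed.

Let moment_E (u : R) N : \int[leb]_(x in (E : set (lebR R))) ((x : R) - u) ^+ (2 * N) =
  ((b - u) ^+ (2 * N).+1 - (a - u) ^+ (2 * N).+1) / (2 * N).+1%:R.
Proof.
rewrite /Rintegral (@integral_E (fun x => ((x - u) ^+ (2 * N))%:E)).
- by rewrite integral_itv_evenX.
- by apply/measurable_EFinP; apply: measurable_funX; exact: measurable_funB.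
- by move=> x; rewrite lee_fin -normr_even_exp exprn_ge0.
Qed.

Lemma interval_moments : exists2 L, 0 < L & [/\ fine (leb (E : set (lebR R))) = L,
  ess_diam E = L &
  forall N, moment_inf E N = L * (L / 2) ^+ (2 * N) / (2 * N).+1%:R].
Proof.
have Lgt0 : 0 < b - a by rewrite subr_gt0.
exists (b - a) => //; split=> [||N]; [by rewrite leb_E|exact: ess_diam_E|].
have finE : (leb (E : set (lebR R)) < +oo)%E by rewrite leb_E ltry.
pose h := (b - a) / 2; have hE : b - a = 2 * h by rewrite /h; field.
have h0 : 0 <= h by rewrite /h divr_ge0// ltW.
have val : (b - a) * ((b - a) / 2) ^+ (2 * N) = 2 * h ^+ (2 * N).+1.
  by rewrite -/h hE exprS mulrA.
rewrite val.
have oddN (x : R) : (- x) ^+ (2 * N).+1 = - x ^+ (2 * N).+1.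
  by rewrite exprNn -signr_odd/= oddM/= expr1 mulN1r.
have n0 : 0 < (2 * N).+1%:R :> R by rewrite ltr0n.
apply/eqP; rewrite eq_le; apply/andP; split.
  apply: le_trans (moment_inf_le E N ((a + b) / 2)) _; rewrite moment_E.
  have -> : b - (a + b) / 2 = h by rewrite /h; field.
  have -> : a - (a + b) / 2 = - h by rewrite /h; field.
  by rewrite oddN opprK -mulr2n mulr_natl.
apply: moment_inf_ge => u; rewrite moment_E ler_pM2r ?invr_gt0//.
(* With d the offset of the midpoint from u, b - u = h + d and a - u = - (h - d), so odd powers
   subtract to the symmetric sum. *)
have -> : a - u = - (h - ((a + b) / 2 - u)) by rewrite /h; field.
rewrite oddN opprK (_ : b - u = h + ((a + b) / 2 - u)); last by rewrite /h; field.
exact: odd_power_midpoint.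
Qed.

End IntervalMoments.

(** * The bounds on the moment error *)

Section EmomBounds.
Context (R : realType).
Local Notation leb := (@completed_lebesgue_measure R).
Variables (A B : set R) (c : R).
Hypotheses (mA : lebesgue_measurable A) (mB : lebesgue_measurable B).
Hypotheses (bA : bounded_set A) (bB : bounded_set B).
Hypotheses (finA : (leb (A : set (lebR R)) < +oo)%E).
Hypotheses (finB : (leb (B : set (lebR R)) < +oo)%E).
Hypothesis c_gt0 : 0 < c.

Let m := c * fine (leb (A : set (lebR R))) * fine (leb (B : set (lebR R))).
Let zeta := pi * c / 2 * ess_diam A * ess_diam B.

Lemma ess_diam_ge0 (E : set R) : lebesgue_measurable E -> bounded_set E ->
  0 <= ess_diam E.
Proof.
move=> mE bE; have [E0|E0] := eqVneq (leb (E : set (lebR R))) 0%E.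
  by rewrite /ess_diam E0 eqxx.
have E_gt0 : (0 < leb (E : set (lebR R)))%E by rewrite lt_neqAle eq_sym E0 measure_ge0.
exact: (@ess_diam_ge R E mE bE E E 0 mE mE).
Qed.

Lemma Emom_ge0 N : 0 <= Emom A B c N.
Proof.
rewrite /Emom mulr_ge0 ?sqrtr_ge0// divr_ge0 ?ler0n// mulr_ge0 ?sqrtr_ge0//.
by rewrite exprn_ge0// !mulr_ge0 ?pi_ge0// ltW.
Qed.

(** At centres attaining both infima, the Taylor bound integrates to exactly the square of
    [Emom]. *)
Lemma Emom_witness N : exists alpha beta (p : {poly R[i]}), (size p <= N)%N /\
  residual_sq A B c alpha beta p <= Emom A B c N ^+ 2.
Proof.
have [alpha aE] := moment_inf_attained mA bA finA N.
have [beta bE] := moment_inf_attained mB bB finB N.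
have [p [pN pb]] := taylor_expi R N.
exists alpha, beta, p; split=> //.
apply: le_trans (residual_sq_le_moment alpha beta mA mB bA bB finA finB c_gt0 pN pb) _.
rewrite (gram_entryE alpha beta mA mB bA bB finA finB c_gt0) addnn -mul2n -aE -bE.
have MA0 := moment_inf_ge0 A N; have MB0 := moment_inf_ge0 B N.
rewrite /Emom [leRHS]exprMn (sqr_sqrtr (mulr_ge0 MA0 MB0)).
rewrite !exprMn (sqr_sqrtr (ltW c_gt0)) -!exprM muln2 -mul2n.
rewrite le_eqVlt; apply/orP; left; apply/eqP; ring.
Qed.

Lemma Emom_le_diam N : Emom A B c N <= Num.sqrt m * (zeta ^+ N / N`!%:R).
Proof.
have MA0 := moment_inf_ge0 A N; have MB0 := moment_inf_ge0 B N.
have DA0 := ess_diam_ge0 mA bA; have DB0 := ess_diam_ge0 mB bB.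
have LA0 : 0 <= fine (leb (A : set (lebR R))) by exact: fine_ge0.
have LB0 : 0 <= fine (leb (B : set (lebR R))) by exact: fine_ge0.
set LA := fine (leb (A : set (lebR R))) in LA0 *.
set LB := fine (leb (B : set (lebR R))) in LB0 *.
have MM : Num.sqrt (moment_inf A N * moment_inf B N) <=
    Num.sqrt (LA * LB) * ((ess_diam A / 2) * (ess_diam B / 2)) ^+ N.
  have q0 : 0 <= ((ess_diam A / 2) * (ess_diam B / 2)) ^+ N.
    by rewrite exprn_ge0// mulr_ge0// divr_ge0.
  rewrite -(ger0_norm q0).
  rewrite -sqrtr_sqr -sqrtrM ?mulr_ge0// ler_sqrt; last first.
    by rewrite mulr_ge0 ?mulr_ge0 ?sqr_ge0.
  rewrite -exprM muln2 -mul2n exprMn mulrACA ler_pM//.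
    exact: moment_inf_le_diam.
  exact: moment_inf_le_diam.
have k0 : 0 <= (2 * pi * c) ^+ N * Num.sqrt c / N`!%:R.
  rewrite divr_ge0 ?ler0n// mulr_ge0 ?sqrtr_ge0// exprn_ge0// !mulr_ge0 ?pi_ge0//.
  exact: ltW.
apply: le_trans (ler_wpM2l k0 MM) _.
rewrite /m -/LA -/LB -(mulrA c) (sqrtrM _ (ltW c_gt0)).
(* This is the origin of pi c / 2: both diameters enter halved against 2 pi c. *)
have -> : zeta = (2 * pi * c) * ((ess_diam A / 2) * (ess_diam B / 2)).
  by rewrite /zeta; field.
rewrite [_ ^+ N in leRHS]exprMn le_eqVlt; apply/orP; left; apply/eqP; ring.
Qed.

Lemma Emom_interval N : is_interval A -> is_interval B ->
  (0 < leb (A : set (lebR R)))%E -> (0 < leb (B : set (lebR R)))%E ->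
  [/\ 0 < m, 0 < zeta &
  Emom A B c N = Num.sqrt m * (zeta ^+ N / (N`!%:R * (2 * N%:R + 1)))].
Proof.
move=> iA iB A0 B0.
have [LA LA0 [mLA dLA momA]] := interval_moments iA bA mA A0.
have [LB LB0 [mLB dLB momB]] := interval_moments iB bB mB B0.
rewrite /m /zeta mLA mLB dLA dLB; split.
- by rewrite !mulr_gt0.
- by rewrite !mulr_gt0 ?pi_gt0.
rewrite /Emom momA momB.
have nE : (2 * N).+1%:R = 2 * N%:R + 1 :> R by rewrite -addn1 natrD natrM.
have n0 : 0 < 2 * N%:R + 1 :> R by rewrite -nE ltr0n.
(* Both moments carry 1/(2N+1), so it sits inside the square and the square root releases it
   once. *)
have -> : LA * (LA / 2) ^+ (2 * N) / (2 * N).+1%:R *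
    (LB * (LB / 2) ^+ (2 * N) / (2 * N).+1%:R) =
    LA * LB * ((LA / 2 * (LB / 2)) ^+ N / (2 * N%:R + 1)) ^+ 2.
  have pw : ((LA / 2 * (LB / 2)) ^+ N) ^+ 2 = (LA / 2) ^+ (2 * N) * (LB / 2) ^+ (2 * N).
    by rewrite -exprM muln2 -mul2n exprMn.
  by rewrite nE (expr_div_n (_ ^+ N)) pw (expr2 (_ + 1)) invfM; ring.
have q0 : 0 <= (LA / 2 * (LB / 2)) ^+ N / (2 * N%:R + 1).
  by rewrite divr_ge0 ?(ltW n0)// exprn_ge0// mulr_ge0// divr_ge0// ltW.
rewrite (sqrtrM _ (mulr_ge0 (ltW LA0) (ltW LB0))) sqrtr_sqr (ger0_norm q0).
rewrite -(mulrA c) (sqrtrM _ (ltW c_gt0)).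
have -> : pi * c / 2 * LA * LB = (2 * pi * c) * ((LA / 2) * (LB / 2)) by field.
rewrite [X in _ = _ * (X / _)]exprMn invfM; ring.
Qed.

End EmomBounds.

Theorem theorem4p4 (R : realType) (A B : set R) (c : R)
    (mA : lebesgue_measurable A) (mB : lebesgue_measurable B)
    (bA : bounded_set A) (bB : bounded_set B)
    (finA : (leb (A : set (lebR R)) < +oo)%E)
    (finB : (leb (B : set (lebR R)) < +oo)%E)
    (c_gt0 : 0 < c) :
  let K := Kop A B c in
  let m := c * fine (leb (A : set (lebR R))) * fine (leb (B : set (lebR R))) in
  let zeta := pi * c / 2 * ess_diam A * ess_diam B in
  (forall (N : nat) (alpha beta : R),
     (exists2 p, p \in poly_below R N &
        residual_sq A B c alpha beta p = poly_residual A B c alpha beta N ^+ 2) /\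
     (singular_value K N.+1 <= (poly_residual A B c alpha beta N)%:E)%E) /\
  (forall (N : nat) (alpha beta : R), (1 <= N)%N ->
     (poly_residual A B c alpha beta N ^+ 2)%:C =
       m%:C - (ctrans (bvec A B c alpha beta N) *m
               mp_inverse (gram A B c alpha beta N) *m
               bvec A B c alpha beta N) ord0 ord0 /\
     (forall j k : nat, (j < N)%N -> (k < N)%N ->
        gram_entry A B c alpha beta j k =
          c * (2 * pi * c) ^+ (j + k) *
          (\int[leb]_(x in (A : set (lebR R))) ((x : R) - alpha) ^+ (j + k)) *
          (\int[leb]_(y in (B : set (lebR R))) ((y : R) - beta) ^+ (j + k)))) /\
  (forall N : nat,
     (exists T : (R -> R[i]) -> (R -> R[i]),
        [/\ L2_operator T, rank_at_most T N
          & (hs_norm (op_sub K T) <= (Emom A B c N)%:E)%E]) /\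
     (singular_value K N.+1 <= (Emom A B c N)%:E)%E /\
     Emom A B c N <= Num.sqrt m * (zeta ^+ N / N`!%:R)) /\
  (is_interval A -> is_interval B ->
   (0 < leb (A : set (lebR R)))%E -> (0 < leb (B : set (lebR R)))%E ->
   forall N : nat,
     Emom A B c N =
       Num.sqrt m * (zeta ^+ N / (N`!%:R * (2 * N%:R + 1))) /\
     ((1 <= N)%N -> Emom A B c N < Num.sqrt m * (zeta ^+ N / N`!%:R))).
Proof.
move=> K m zeta.
split; [|split; [|split]].
- move=> N alpha beta; split.
    exists (best_poly A B c alpha beta N); first by apply/mem_set; exact: size_best_poly.
    by rewrite (poly_residual_sq alpha beta mA mB bA bB finA finB c_gt0).
  apply: (singular_value_residual mA mB bA bB finA finB c_gt0
    (size_best_poly A B c alpha beta N)); first exact: sqrtr_ge0.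
  by rewrite (poly_residual_sq alpha beta mA mB bA bB finA finB c_gt0).
- move=> N alpha beta _; split.
    exact: (poly_residual_gram alpha beta mA mB bA bB finA finB c_gt0).
  move=> j k _ _.
  exact: (gram_entryE alpha beta mA mB bA bB finA finB c_gt0).
- move=> N.
  have [alpha [beta [p [pN pE]]]] := Emom_witness mA mB bA bB finA finB c_gt0 N.
  have E0 := Emom_ge0 A B c_gt0 N.
  split; last split.
  + exists (kernel_op leb (approx_kernel A B c alpha beta p)); split.
    * apply: kernel_op_L2_operator.
      exact: (hs_approx_kernel alpha beta mA mB bA bB finA finB c_gt0 pN).
    * exact: (rank_approx alpha beta mA mB bA bB finA finB c_gt0 pN).
    * exact: (hs_norm_residual mA mB bA bB finA finB c_gt0 pN E0 pE).
  + exact: (singular_value_residual mA mB bA bB finA finB c_gt0 pN E0 pE).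
  + exact: (Emom_le_diam mA mB bA bB finA finB c_gt0).
- move=> iA iB A0 B0 N.
  have [m0 z0 EE] := Emom_interval mA mB bA bB c_gt0 N iA iB A0 B0.
  (* As m and zeta are positive, the strict inequality comes down to 2N + 1 > 1. *)
  split=> // N1; rewrite EE ltr_pM2l ?sqrtr_gt0// ltr_pM2l ?exprn_gt0//.
  have N0 : 0 < N%:R :> R by rewrite ltr0n.
  have f0 : 0 < N`!%:R :> R by rewrite ltr0n fact_gt0.
  have d0 : 1 < 2 * N%:R + 1 :> R by rewrite ltrDr mulr_gt0.
  by rewrite ltf_pV2 ?posrE ?mulr_gt0 ?(lt_trans ltr01 d0)// ltr_pMr.
Qed.
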